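(* Suppose that $S$ is a free normal Suslin tree. Then for any positive integer $n$, there exists a c.c.c. forcing poset which forces that $S$ is $n$-free but all derived trees of $S$ of dimension greater than $n$ are special.
   Context: A Suslin tree is a tree of height $\omega_1$ with no uncountable chain or antichain. A tree is normal if it has a root, every element has at least two immediate successors, every element has elements above it at every higher level, and every chain of limit order type has at most one upper bound. A tree $T$ of height $\omega_1$ is special if there is $f : T \to \omega$ with $f(x) \neq f(y)$ whenever $x <_T y$. For $a \in T$, $T_a$ is the subtree of all $b \in T$ with $b \le_T a$ or $a \le_T b$. For $\omega_1$-trees $T_0,\ldots,T_{n-1}$, $T_0 \otimes \cdots \otimes T_{n-1}$ is the set of $n$-tuples $(x_0,\ldots,x_{n-1}) \in T_0 \times \cdots \times T_{n-1}$ whose entries all have the same height, ordered componentwise. For a positive integer $n$ and an $n$-tuple $\vec a = (a_0,\ldots,a_{n-1})$ of distinct elements of $T$ of the same height, $T_{\vec a} := T_{a_0} \otimes \cdots \otimes T_{a_{n-1}}$ is a derived tree of $T$ of dimension $n$. $T$ is $n$-free if all its derived trees of dimension $n$ are Suslin, and free if it is $n$-free for every positive integer $n$. *)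

(* Defs.v *)
From mathcomp Require Import all_boot.

Set Implicit Arguments.
Unset Strict Implicit.
Unset Printing Implicit Defensive.

(** The ground model V is the ambient type theory.  Formulas quantify over the
    elements of a ground-model type [X] ([All], [Ex]) and over the subsets of
    such an [X] ([AllSet], [ExSet]); functions and relations are subsets of a
    product.  [N X] is the type of terms denoting subsets of [X]: actual subsets
    when a formula is read in V, P-names when it is read in V[G].  All the
    tree-theoretic notions below are formulas, generic in [N], so the very same
    definition is evaluated in V ([holds]) and in V[G] ([forces]).

    [Ground a] is meant for atomic facts about elements of V only (equality, the
    order of the given tree, the order of nat), which are absolute; anything
    that quantifies over the universe is built with the other constructors. *)

Inductive form (N : Type -> Type) : Type :=
| Ground (a : Prop)
| Mem (X : Type) (x : X) (A : N X)
| Not (f : form N)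
| And (f g : form N)
| Or (f g : form N)
| Imp (f g : form N)
| All (X : Type) (f : X -> form N)
| Ex (X : Type) (f : X -> form N)
| AllSet (X : Type) (f : N X -> form N)
| ExSet (X : Type) (f : N X -> form N).

Declare Scope forcing_scope.
Delimit Scope forcing_scope with form.
Bind Scope forcing_scope with form.

Arguments Ground {N} a%_type_scope.
Arguments Mem {N X} x A.
Arguments Not {N} f%_forcing_scope.
Arguments And {N} (f g)%_forcing_scope.
Arguments Or {N} (f g)%_forcing_scope.
Arguments Imp {N} (f g)%_forcing_scope.
Arguments All {N X} f%_forcing_scope.
Arguments Ex {N X} f%_forcing_scope.
Arguments AllSet {N X} f%_forcing_scope.
Arguments ExSet {N X} f%_forcing_scope.

Notation "~ f" := (Not f) : forcing_scope.
Notation "f /\ g" := (And f g) : forcing_scope.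
Notation "f \/ g" := (Or f g) : forcing_scope.
Notation "f --> g" := (Imp f g)
  (at level 90, right associativity) : forcing_scope.
Notation "f <-> g" := (And (Imp f g) (Imp g f)) : forcing_scope.
Notation "'FORALL' x .. y , f" := (All (fun x => .. (All (fun y => f)) ..))
  (at level 200, x binder, y binder, right associativity) : forcing_scope.
Notation "'EXISTS' x .. y , f" := (Ex (fun x => .. (Ex (fun y => f)) ..))
  (at level 200, x binder, y binder, right associativity) : forcing_scope.
Notation "'FORALLSET' x .. y , f" :=
  (AllSet (fun x => .. (AllSet (fun y => f)) ..))
  (at level 200, x binder, y binder, right associativity) : forcing_scope.
Notation "'EXISTSSET' x .. y , f" :=
  (ExSet (fun x => .. (ExSet (fun y => f)) ..))
  (at level 200, x binder, y binder, right associativity) : forcing_scope.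

Definition groundset (X : Type) : Type := X -> Prop.

Fixpoint holds (f : form groundset) : Prop :=
  match f with
  | Ground a => a
  | Mem X x A => A x
  | Not f => ~ holds f
  | And f g => holds f /\ holds g
  | Or f g => holds f \/ holds g
  | Imp f g => holds f -> holds g
  | All X f => forall x : X, holds (f x)
  | Ex X f => exists x : X, holds (f x)
  | AllSet X f => forall A : groundset X, holds (f A)
  | ExSet X f => exists A : groundset X, holds (f A)
  end.

(** A P-name for a subset of [X]: a set of pairs (check-name of x, condition).
    Every subset of a ground-model set in V[G] is the value of such a name. *)
Definition name (P X : Type) : Type := X -> P -> Prop.

Section Forcing.

Variables (P : Type) (leP : P -> P -> Prop).

(** [leP q p] : q extends p, i.e. q is a stronger condition than p. *)
Fixpoint forces (p : P) (f : form (name P)) : Prop :=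
  match f with
  | Ground a => a
  | Mem X x A =>
      forall q, leP q p -> exists r s, [/\ leP r q, A x s & leP r s]
  | Not f => forall q, leP q p -> ~ forces q f
  | And f g => forces p f /\ forces p g
  | Or f g => forall q, leP q p ->
      exists r, leP r q /\ (forces r f \/ forces r g)
  | Imp f g => forall q, leP q p -> forces q f -> forces q g
  | All X f => forall x : X, forces p (f x)
  | Ex X f =>
      forall q, leP q p -> exists r, leP r q /\ exists x : X, forces r (f x)
  | AllSet X f => forall A : name P X, forces p (f A)
  | ExSet X f =>
      forall q, leP q p ->
        exists r, leP r q /\ exists A : name P X, forces r (f A)
  end.

Definition forcing_poset : Prop :=
  inhabited P /\
  [/\ forall p, leP p p,
      forall p q r, leP p q -> leP q r -> leP p r
    & forall p q, leP p q -> leP q p -> p = q].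

Definition compatible (p q : P) : Prop := exists r, leP r p /\ leP r q.

Definition ccc : Prop :=
  forall A : P -> Prop,
    (forall p q, A p -> A q -> p <> q -> ~ compatible p q) ->
    exists e : P -> nat, forall p q, A p -> A q -> e p = e q -> p = q.

End Forcing.

Section Trees.

Variable N : Type -> Type.

Section Basics.

Variables X Y : Type.

Definition is_function (A : X -> form N) (B : Y -> form N) (F : N (X * Y)) :=
  ((FORALL x y, Mem (x, y) F --> A x /\ B y) /\
   (FORALL x, A x -->
      EXISTS y, Mem (x, y) F /\ FORALL z, Mem (x, z) F --> Ground (z = y)))%form.

End Basics.

Definition countable X (A : X -> form N) : form N :=
  (EXISTSSET F : N (X * nat),
     is_function A (fun _ => Ground True) F /\
     FORALL x y n, Mem (x, n) F --> Mem (y, n) F --> Ground (x = y))%form.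

Record structure (X : Type) := Structure {
  dom : X -> form N;
  tle : X -> X -> form N
}.

Definition ground X (le : X -> X -> Prop) : structure X :=
  Structure (fun _ => Ground True) (fun x y => Ground (le x y)).

Definition tlt X (T : structure X) (x y : X) : form N :=
  (tle T x y /\ ~ Ground (x = y))%form.

Definition below X (T : structure X) (x y : X) : form N :=
  (dom T y /\ tlt T y x)%form.

Definition is_tree X (T : structure X) : form N :=
  ((FORALL x, dom T x --> tle T x x) /\
   (FORALL x y z, dom T x --> dom T y --> dom T z -->
      tle T x y --> tle T y z --> tle T x z) /\
   (FORALL x y, dom T x --> dom T y -->
      tle T x y --> tle T y x --> Ground (x = y)) /\
   (FORALL x, dom T x -->
      FORALLSET A : N X,
        (FORALL y, Mem y A --> below T x y) -->
        (EXISTS y, Mem y A) -->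
        EXISTS m, Mem m A /\ FORALL y, Mem y A --> tle T m y))%form.

(** The height of x is the order type of the set of its predecessors, so x in T
    and y in U have the same height iff these sets are isomorphic. *)
Definition same_height X Y (T : structure X) (x : X) (U : structure Y) (y : Y)
    : form N :=
  (EXISTSSET F : N (X * Y),
     is_function (below T x) (below U y) F /\
     (FORALL v, below U y v --> EXISTS u, Mem (u, v) F) /\
     FORALL u v u' v', Mem (u, v) F --> Mem (u', v') F -->
       (tle T u u' <-> tle U v v'))%form.

Definition lower_height X (T : structure X) (x y : X) : form N :=
  (EXISTS w, below T y w /\ same_height T x T w)%form.

(** The height of T is the ordinal {ht(x) : x in T}.  It is omega_1, the least
    uncountable ordinal, iff every ht(x) is countable and there are uncountably
    many heights, i.e. no map T -> omega separates elements of distinct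
    heights. *)
Definition height_omega1 X (T : structure X) : form N :=
  ((FORALL x, dom T x --> countable (below T x)) /\
   ~ EXISTSSET F : N (X * nat),
       is_function (dom T) (fun _ => Ground True) F /\
       FORALL x y n, Mem (x, n) F --> Mem (y, n) F -->
         same_height T x T y)%form.

Definition chain X (T : structure X) (A : N X) : form N :=
  ((FORALL x, Mem x A --> dom T x) /\
   (FORALL x y, Mem x A --> Mem y A --> tle T x y \/ tle T y x))%form.

Definition antichain X (T : structure X) (A : N X) : form N :=
  ((FORALL x, Mem x A --> dom T x) /\
   (FORALL x y, Mem x A --> Mem y A --> tle T x y --> Ground (x = y)))%form.

Definition suslin X (T : structure X) : form N :=
  (is_tree T /\ height_omega1 T /\
   FORALLSET A : N X, chain T A \/ antichain T A -->
     countable (fun x => Mem x A))%form.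

Definition special X (T : structure X) : form N :=
  (is_tree T /\ height_omega1 T /\
   EXISTSSET F : N (X * nat),
     is_function (dom T) (fun _ => Ground True) F /\
     FORALL x y n, Mem (x, n) F --> Mem (y, n) F --> ~ tlt T x y)%form.

Definition immediate_succ X (T : structure X) (x y : X) : form N :=
  (dom T y /\ tlt T x y /\
   ~ EXISTS z, dom T z /\ tlt T x z /\ tlt T z y)%form.

Definition upper_bound X (T : structure X) (A : N X) (u : X) : form N :=
  (dom T u /\ FORALL x, Mem x A --> tle T x u)%form.

Definition minimal_upper_bound X (T : structure X) (A : N X) (u : X) : form N :=
  (upper_bound T A u /\
   ~ EXISTS v, upper_bound T A v /\ tlt T v u)%form.

(** In the last clause the upper bound has to be a minimal one: an upper bound
    that has elements above it is never the only one. *)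
Definition normal X (T : structure X) : form N :=
  ((EXISTS r, dom T r /\ FORALL x, dom T x --> tle T r x) /\
   (FORALL x, dom T x -->
      EXISTS y z, immediate_succ T x y /\ immediate_succ T x z /\
        ~ Ground (y = z)) /\
   (FORALL x z, dom T x --> dom T z --> lower_height T x z -->
      EXISTS y, dom T y /\ tlt T x y /\ same_height T y T z) /\
   (FORALLSET C : N X,
      chain T C -->
      (EXISTS x, Mem x C) -->
      (FORALL x, Mem x C --> EXISTS y, Mem y C /\ tlt T x y) -->
      FORALL u v, minimal_upper_bound T C u --> minimal_upper_bound T C v -->
        Ground (u = v)))%form.

Definition cone X (T : structure X) (a : X) : structure X :=
  Structure (fun b => dom T b /\ (tle T b a \/ tle T a b))%form (tle T).

Definition tensor X n (T : 'I_n -> structure X) : structure (n.-tuple X) :=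
  Structure
    (fun x => (FORALL i, dom (T i) (tnth x i)) /\
              (FORALL i j,
                 same_height (T i) (tnth x i) (T j) (tnth x j)))%form
    (fun x y => FORALL i, tle (T i) (tnth x i) (tnth y i))%form.

Definition distinct_level_tuple X (T : structure X) n (a : n.-tuple X)
    : form N :=
  ((FORALL i, dom T (tnth a i)) /\
   (FORALL i j, ~ Ground (i = j) --> ~ Ground (tnth a i = tnth a j)) /\
   (FORALL i j, same_height T (tnth a i) T (tnth a j)))%form.

Definition derived X (T : structure X) n (a : n.-tuple X)
    : structure (n.-tuple X) :=
  tensor (fun i => cone T (tnth a i)).

Definition n_free X n (T : structure X) : form N :=
  (FORALL a : n.-tuple X,
     distinct_level_tuple T a --> suslin (derived T a))%form.

Definition free X (T : structure X) : form N :=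
  (FORALL n : nat, Ground (0 < n) --> n_free n T)%form.

Definition derived_special_above X n (T : structure X) : form N :=
  (FORALL m : nat, Ground (n < m) -->
     FORALL a : m.-tuple X,
       distinct_level_tuple T a --> special (derived T a))%form.

End Trees.

Arguments ground {N X} le.

(* Main.v *)
Require Import Defs.
From mathcomp Require Import all_boot.
From mathcomp Require Import boolp.

Set Implicit Arguments.
Unset Strict Implicit.
Unset Printing Implicit Defensive.

(** Force with finite partial functions from the set of injective (n+1)-tuples
    of nodes of equal height to the natural numbers which give distinct values
    to comparable tuples.  The generic function specializes the derived trees
    of dimension n+1, hence, by projection, those of every dimension above n.

    Both the chain condition and the preservation of n-freeness reduce to one
    amalgamation fact: among uncountably many conditions p_i, each paired with
    a node x_i of a derived tree of dimension at most n, there are two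
    compatible ones with x_i < x_j.  First thin out so that the nodes mentioned
    by p_i and x_i form a Delta-system and, apart from the root, split below a
    fixed level; their traces on that level then span a derived tree of S.
    That tree is Suslin, so the traces are dense above one of its elements e.
    Now choose p_i and p_j through two extensions of e that agree exactly on the
    coordinates of x_i.  A conflict between p_i and p_j would be a comparable
    pair of (n+1)-tuples, and all n+1 distinct coordinates of that pair would
    have to be among the at most n coordinates of x_i. *)

(** * Countable sets *)

Definition ctb (I : Type) (D : I -> Prop) : Prop :=
  exists e : I -> nat, forall x y, D x -> D y -> e x = e y -> x = y.

Definition big (I : Type) (D : I -> Prop) : Prop := ~ ctb D.

Lemma ctb_sub I (D E : I -> Prop) : (forall x, D x -> E x) -> ctb E -> ctb D.
Proof. by move=> DE [e eP]; exists e => x y /DE Ex /DE Ey; apply: eP. Qed.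

Lemma ctb_preim I K (f : I -> K) (D : I -> Prop) (E : K -> Prop) :
  (forall x, D x -> E (f x)) ->
  (forall x y, D x -> D y -> f x = f y -> x = y) -> ctb E -> ctb D.
Proof.
move=> DE finj [e eP]; exists (e \o f) => x y Dx Dy /= /eP efg.
by apply: finj => //; apply: efg; apply: DE.
Qed.

Lemma ctb_countType (K : countType) (D : K -> Prop) : ctb D.
Proof. by exists pickle => x y _ _; apply: pcan_inj (@pickleK K) x y. Qed.

Lemma ctb_bigcup I K (B : K -> Prop) (F : K -> I -> Prop) :
  ctb B -> (forall b, B b -> ctb (F b)) -> ctb (fun x => exists2 b, B b & F b x).
Proof.
move=> [c cP] Fc.
have [e eP] : exists e : K -> I -> nat, forall b, B b ->
    forall x y, F b x -> F b y -> e b x = e b y -> x = y.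
  have /choice [e eP] b : exists e : I -> nat, B b ->
      forall x y, F b x -> F b y -> e x = e y -> x = y.
    by have [/Fc[e eP]|nB] := pselect (B b); [exists e|exists (fun=> 0)].
  by exists e.
have [b0 bP] : exists b0 : I -> option K, forall x,
    (exists2 b, B b & F b x) -> exists2 b, b0 x = Some b & B b /\ F b x.
  have /choice [b0 bP] x : exists o : option K,
      (exists2 b, B b & F b x) -> exists2 b, o = Some b & B b /\ F b x.
    have [[b Bb Fb]|nB] := pselect (exists2 b, B b & F b x); last by exists None.
    by exists (Some b) => _; exists b.
  by exists b0.
exists (fun x => if b0 x is Some b then pickle (c b, e b x) else 0).
move=> x y /bP[b -> [Bb Fx]] /bP[b' -> [Bb' Fy]].
move/(pcan_inj (@pickleK _)) => -[/cP bb']; rewrite -bb' // in Fy *.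
exact: eP.
Qed.

Lemma ctb_cup I (D E : I -> Prop) : ctb D -> ctb E -> ctb (fun x => D x \/ E x).
Proof.
move=> Dc Ec; apply: (@ctb_sub _ _ (fun x => exists2 b : bool, True & if b then D x else E x)).
  by move=> x [Dx|Ex]; [exists true|exists false].
by apply: ctb_bigcup => [|[] _]; first exact: ctb_countType.
Qed.

Lemma ctb_image (J : countType) I (f : J -> I) : ctb (fun x => exists j, x = f j).
Proof.
apply: (@ctb_sub _ _ (fun x => exists2 j, True & x = f j)).
  by move=> x [j ->]; exists j.
apply: ctb_bigcup; first exact: ctb_countType.
by move=> j _; exists (fun=> 0) => x y -> ->.
Qed.

Lemma ctb_fun (J : finType) I (B : I -> Prop) :
  ctb B -> ctb (fun f : J -> I => forall j, B (f j)).
Proof.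
move=> [e eP]; exists (fun f => pickle [ffun j => e (f j)]) => f g Bf Bg.
move/(pcan_inj (@pickleK _))/ffunP => fg; apply/funext => j.
by have := fg j; rewrite !ffunE => /eP; apply.
Qed.

Lemma big_sub I (D E : I -> Prop) : (forall x, D x -> E x) -> big D -> big E.
Proof. by move=> DE bD /(ctb_sub DE). Qed.

Lemma big_ex I (D : I -> Prop) : big D -> exists i, D i.
Proof.
move=> bD; apply: contrapT => nD; apply: bD; exists (fun=> 0) => x y Dx.
by case: nD; exists x.
Qed.

Lemma big_minus I (D E : I -> Prop) :
  big D -> ctb (fun i => D i /\ E i) -> big (fun i => D i /\ ~ E i).
Proof.
move=> bD cE cD; apply: bD; apply: ctb_sub (ctb_cup cE cD) => x Dx.
by have [] := pselect (E x); [left|right].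
Qed.

(** Otherwise [D] would be a countable union of countable sets. [G] is a relation, so an index need
    not determine its class. *)
Lemma big_pigeon I K (D : I -> Prop) (B : K -> Prop) (G : I -> K -> Prop) :
  big D -> ctb B -> (forall i, D i -> exists2 b, B b & G i b) ->
  exists2 b, B b & big (fun i => D i /\ G i b).
Proof.
move=> bD cB DG; apply: contrapT => nb; apply: bD.
apply: (@ctb_sub _ _ (fun i => exists2 b, B b & D i /\ G i b)).
  by move=> i Di; have [b Bb Gb] := DG i Di; exists b.
apply: ctb_bigcup => // b Bb; apply: contrapT => nc; apply: nb.
by exists b.
Qed.

(** * Comparison of heights *)

Section Rank.

Variables X Y : Type.
Implicit Types (T : structure groundset X) (U : structure groundset Y).

(** The height of [x] in [T] is at most that of [y] in [U]. *)
Inductive hle T U (x : X) (y : Y) : Prop :=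
  HLe of forall u, holds (below T x u) ->
    exists2 v, holds (below U y v) & hle T U u v.

End Rank.

Definition heq X Y (T : structure groundset X) (U : structure groundset Y) x y :=
  hle T U x y /\ hle U T y x.

Section Tree.

Variables (X : Type) (T : structure groundset X).
Hypothesis treeT : holds (is_tree T).

Let D x := holds (dom T x).
Let L x y := holds (tle T x y).

Lemma tree_refl x : D x -> L x x.
Proof. by case: treeT => H _; apply: H. Qed.

Lemma tree_trans y x z : D x -> D y -> D z -> L x y -> L y z -> L x z.
Proof. by case: treeT => _ [H _]; apply: H. Qed.

Lemma tree_anti x y : D x -> D y -> L x y -> L y x -> x = y.
Proof. by case: treeT => _ [_ [H _]]; apply: H. Qed.

Lemma tree_min x (A : X -> Prop) : D x -> (forall y, A y -> holds (below T x y)) ->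
  (exists y, A y) -> exists2 m, A m & forall y, A y -> L m y.
Proof.
case: treeT => _ [_ [_ H]] Dx AB A0.
by have [m [Am mP]] := H x Dx A AB A0; exists m.
Qed.

Lemma tree_linear x u v :
  holds (below T x u) -> holds (below T x v) -> D x -> L u v \/ L v u.
Proof.
move=> xu xv Dx.
have [| |m [->|->] mP] := @tree_min x (fun y => y = u \/ y = v) Dx.
- by move=> y [->|->].
- by exists u; left.
- by left; apply: mP; right.
- by right; apply: mP; left.
Qed.

Lemma tree_linear_le x u v :
  D x -> D u -> D v -> L u x -> L v x -> L u v \/ L v u.
Proof.
move=> Dx Du Dv ux vx.
have [->|nux] := pselect (u = x); first by right.
have [->|nvx] := pselect (v = x); first by left.
exact: (@tree_linear x).
Qed.

Lemma below_trans x y z :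
  D x -> holds (below T x y) -> holds (below T y z) -> holds (below T x z).
Proof.
move=> Dx [Dy [yx nyx]] [Dz [zy nzy]]; split=> //; split.
  exact: tree_trans yx.
move=> /= zx; rewrite zx in Dz zy; apply: nyx; exact: tree_anti.
Qed.

Lemma below_le_trans x y z :
  D x -> L y x -> holds (below T y z) -> D y -> holds (below T x z).
Proof.
move=> Dx yx zy Dy; have [xy|nxy] := pselect (y = x); first by rewrite -xy.
by apply: (below_trans _ _ zy) => //; split.
Qed.

(** Every counterexample has another one below it, so the counterexamples below the first form a
    nonempty set without least element, against [tree_min]. *)
Lemma tree_ind (Q : X -> Prop) :
  (forall x, D x -> (forall u, holds (below T x u) -> Q u) -> Q x) ->
  forall x, D x -> Q x.
Proof.
move=> IH x Dx; apply: contrapT => nQ.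
have step y : D y -> ~ Q y -> exists2 u, holds (below T y u) & ~ Q u.
  move=> Dy nQy; apply: contrapT => nu; apply: nQy; apply: IH => // u yu.
  by apply: contrapT => nQu; apply: nu; exists u.
have [| |m [xm nQm] mP] := @tree_min x (fun y => holds (below T x y) /\ ~ Q y) Dx.
- by move=> y [].
- by have [u] := step x Dx nQ; exists u.
have Dm : D m by case: xm.
have [u mu nQu] := step m Dm nQm.
have mLu : L m u by apply: mP; split=> //; apply: below_trans mu.
by case: mu => Du [um] []; apply: tree_anti.
Qed.

Lemma hle_mono x y : D x -> D y -> L x y -> hle T T x y.
Proof.
move=> Dx; elim/tree_ind: x / Dx y => x Dx IH y Dy xy; constructor=> u xu.
exists u; first exact: below_le_trans xu Dx.
by have Du : D u by [case: xu]; apply: IH => //; apply: tree_refl.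
Qed.

Lemma hle_refl x : D x -> hle T T x x.
Proof. by move=> Dx; apply: hle_mono => //; apply: tree_refl. Qed.

Lemma hle_trans Y Z (U : structure groundset Y) (V : structure groundset Z) x y z :
  D x -> hle T U x y -> hle U V y z -> hle T V x z.
Proof.
move=> Dx; elim/tree_ind: x / Dx y z => x Dx IH y z [xy] [yz].
constructor=> u xu; have [v yv uv] := xy u xu; have [w zw vw] := yz v yv.
by exists w => //; apply: IH uv vw.
Qed.

(** Trichotomy: when [x] is not at most as high as [y], it is strictly higher, witnessed by a
    predecessor that no node below [y] dominates. *)
Lemma hle_total Y (U : structure groundset Y) x y :
  D x -> ~ hle T U x y -> exists2 u, holds (below T x u) & hle U T y u.
Proof.
move=> Dx; elim/tree_ind: x / Dx y => x Dx IH y nxy.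
have [u xu nu] : exists2 u, holds (below T x u) &
    forall v, holds (below U y v) -> ~ hle T U u v.
  apply: contrapT => nu; apply: nxy; constructor=> u xu.
  apply: contrapT => nv; apply: nu; exists u => // v yv uv.
  by apply: nv; exists v.
exists u => //; constructor=> v yv.
exact: IH (nu v yv).
Qed.

(** Infinite descent: a predecessor of [u] dominating [u] would give a smaller counterexample. *)
Lemma hle_below x u : D x -> holds (below T x u) -> ~ hle T T x u.
Proof.
move=> Dx; elim/tree_ind: x / Dx u => x Dx IH u xu [xleu].
have [v uv ulev] := xleu u xu.
exact: IH uv ulev.
Qed.

Lemma hle_comparable x y : D x -> D y -> hle T T y x -> L x y -> x = y.
Proof.
move=> Dx Dy yx xy; apply: contrapT => nxy.
by apply: (@hle_below y x Dy).
Qed.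

Lemma hle_le z x y :
  D x -> D y -> D z -> L x z -> L y z -> hle T T x y -> L x y.
Proof.
move=> Dx Dy Dz xz yz xy; have [//|yx] := tree_linear_le Dz Dx Dy xz yz.
by rewrite (hle_comparable Dy Dx xy yx); apply: tree_refl.
Qed.

Lemma hle_or x y : D x -> D y -> hle T T x y \/ hle T T y x.
Proof.
move=> Dx Dy; have [|nxy] := pselect (hle T T x y); first by left.
have [u xu yu] := hle_total Dx nxy; right; apply: hle_trans yu _ => //.
by case: xu => Du [ux _]; apply: hle_mono.
Qed.

Lemma heq_refl x : D x -> heq T T x x.
Proof. by move=> Dx; split; apply: hle_refl. Qed.

(** Projection of a node to a lower level. Either [x] already has the height of [g], or trichotomy
    gives a predecessor still at least as high, and the descent continues there. *)
Lemma restriction Y (U : structure groundset Y) g x : holds (is_tree U) ->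
  holds (dom U g) ->
  D x -> hle U T g x -> exists2 y, D y /\ L y x & heq U T g y.
Proof.
move=> treeU Dg Dx; elim/tree_ind: x / Dx => x Dx IH gx.
have [xg|nxg] := pselect (hle T U x g).
  by exists x => //; split=> //; apply: tree_refl.
have [u xu gu] := hle_total Dx nxg.
have [y [Dy yu] gy] := IH u xu gu.
exists y => //; split=> //; case: xu => Du [ux _].
exact: tree_trans ux.
Qed.

End Tree.

Lemma heq_sym X Y (T : structure groundset X) (U : structure groundset Y) x y :
  heq T U x y -> heq U T y x.
Proof. by case. Qed.

Lemma heq_trans X Y Z (T : structure groundset X) (U : structure groundset Y)
    (V : structure groundset Z) x y z :
  holds (is_tree T) -> holds (is_tree V) ->
  holds (dom T x) -> holds (dom V z) ->
  heq T U x y -> heq U V y z -> heq T V x z.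
Proof.
by move=> tT tV Dx Dz [xy yx] [yz zy]; split; [apply: hle_trans yz|apply: hle_trans yx].
Qed.

(** [W] is the set of forcing conditions below a given one, and [G q] the
    relation that [q] forces to be the isomorphism; a singleton [W] gives the
    isomorphisms of the ground model. *)
Lemma iso_hle X Y (T : structure groundset X) (U : structure groundset Y) x y
    (W : Type) (leW : W -> W -> Prop) (G : W -> X -> Y -> Prop) (w0 : W) :
  holds (is_tree T) -> holds (dom T x) ->
  (forall q q' u v, leW q' q -> G q u v -> G q' u v) ->
  (forall q u v, G q u v -> holds (below T x u) /\ holds (below U y v)) ->
  (forall q u, holds (below T x u) -> exists q' v, leW q' q /\ G q' u v) ->
  (forall q u v u' v', G q u v -> G q u' v' ->
     (holds (tle T u u') <-> holds (tle U v v'))) ->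
  hle T U x y.
Proof.
move=> tT Dx Gmono Gdom Gtot Gord.
have key u : holds (dom T u) -> forall q v, G q u v -> hle T U u v.
  move=> Du; elim/(tree_ind tT): u / Du => u Du IH q v Guv.
  constructor=> u' uu'; have [xu yv] := Gdom _ _ _ Guv.
  have [q' [v' [qq' Gq']]] := Gtot q u' (below_trans tT Dx xu uu').
  have Gq := Gmono _ _ _ _ qq' Guv.
  exists v'; last exact: IH Gq'.
  case: uu' => Du' [u'u nu'u].
  split; first by case: (Gdom _ _ _ Gq') => _ [].
  split; first by apply/(Gord q' u' v' u v).
  move=> vv; apply: nu'u; apply: (tree_anti tT) => //.
  apply/(Gord q' u v u' v' Gq Gq'); rewrite vv.
  by apply/(Gord q' u v u v Gq Gq); apply: tree_refl.
constructor=> u xu; have [q [v [_ Gq]]] := Gtot w0 u xu.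
exists v; first by case: (Gdom _ _ _ Gq).
by apply: key Gq; case: xu.
Qed.

(** The predecessors of a node form a chain, on which each height occurs at most once; hence pairing
    predecessors of equal height is a well-defined order isomorphism. *)
Lemma heq_iso X Y (T : structure groundset X) (U : structure groundset Y) x y
    (F : X -> Y -> Prop) :
  F = (fun u v => [/\ holds (below T x u), holds (below U y v) & heq T U u v]) ->
  holds (is_tree T) -> holds (is_tree U) ->
  holds (dom T x) -> holds (dom U y) -> heq T U x y ->
  [/\ forall u, holds (below T x u) -> exists2 v, F u v & forall v', F u v' -> v' = v,
      forall v, holds (below U y v) -> exists u, F u v
    & forall u v u' v', F u v -> F u' v' ->
        (holds (tle T u u') <-> holds (tle U v v'))].
Proof.
move=> -> tT tU Dx Dy [[xy] [yx]].
have half X' Y' (T' : structure groundset X') (U' : structure groundset Y') x' y' :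
    holds (is_tree T') -> holds (is_tree U') ->
    holds (dom T' x') -> holds (dom U' y') -> forall u v u' v',
    holds (below T' x' u) -> holds (below U' y' v) -> heq T' U' u v ->
    holds (below T' x' u') -> holds (below U' y' v') -> heq T' U' u' v' ->
    holds (tle T' u u') -> holds (tle U' v v').
  move=> tT' tU' Dx' Dy' u v u' v' [Du [ux _]] [Dv [vy _]] [uv vu]
    [Du' [ux' _]] [Dv' [vy' _]] [uv' vu'] uu'.
  apply: (hle_le tU' Dv Dv' Dy') => //; apply: (hle_trans tU' Dv vu).
  by apply: (hle_trans tT' Du _ uv'); apply: hle_mono.
have swap u v u' v' : heq T U u v -> heq T U u' v' ->
    holds (below T x u) -> holds (below U y v) ->
    holds (below T x u') -> holds (below U y v') ->
    holds (tle T u u') <-> holds (tle U v v').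
  move=> uv uv' xu yv xu' yv'; split; first exact: (half _ _ _ _ x y).
  by apply: (half _ _ _ _ y x) => //; apply: heq_sym.
have exF X' Y' (T' : structure groundset X') (U' : structure groundset Y') x' y' :
    holds (is_tree T') -> holds (is_tree U') ->
    holds (dom T' x') -> holds (dom U' y') ->
    (forall u, holds (below T' x' u) ->
      exists2 v, holds (below U' y' v) & hle T' U' u v) ->
    forall u, holds (below T' x' u) ->
      exists2 v, holds (below U' y' v) & heq T' U' u v.
  move=> tT' tU' Dx' Dy' H u xu; have [v yv uv] := H u xu.
  have [Du Dv] : holds (dom T' u) /\ holds (dom U' v) by case: xu yv => ? _ [].
  have [w [Dw wv] uw] := restriction tU' tT' Du Dv uv.
  exists w => //.
  have [<-//|nwv] := pselect (v = w).
  by apply: (below_trans tU' Dy' yv); split=> //; split=> // /esym.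
split.
- move=> u xu; have [v yv uv] := exF _ _ _ _ _ _ tT tU Dx Dy xy u xu.
  exists v => // v' [_ yv' uv'].
  have [Dv Dv'] : holds (dom U v) /\ holds (dom U v') by case: yv yv' => ? _ [].
  have Luu : holds (tle T u u) by apply: tree_refl => //; case: xu.
  by apply: (tree_anti tU) => //;
    [apply/(swap u v' u v uv' uv)|apply/(swap u v u v' uv uv')].
- move=> v yv; have [u xu uv] := exF _ _ _ _ _ _ tU tT Dy Dx yx v yv.
  by exists u; split=> //; apply: heq_sym.
- by move=> u v u' v' [xu yv uv] [xu' yv' uv']; apply: swap.
Qed.

Lemma holds_same_height X Y (T : structure groundset X)
    (U : structure groundset Y) x y :
  holds (is_tree T) -> holds (is_tree U) ->
  holds (dom T x) -> holds (dom U y) ->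
  holds (same_height T x U y) <-> heq T U x y.
Proof.
move=> tT tU Dx Dy; split.
  move=> /= [F [[Fdom Ffun] [Fsurj Ford]]].
  split.
    apply: (@iso_hle _ _ _ _ _ _ unit (fun _ _ => True) (fun _ u v => F (u, v)) tt).
    - by [].
    - by [].
    - by [].
    - by move=> _ u v /Fdom.
    - by move=> _ u xu; have [v [uv _]] := Ffun u xu; exists tt, v.
    - move=> _ u v u' v' uv uv'; have [] := Ford u v u' v' uv uv'.
      by split.
  apply: (@iso_hle _ _ _ _ _ _ unit (fun _ _ => True) (fun _ v u => F (u, v)) tt).
  - by [].
  - by [].
  - by [].
  - by move=> _ u v /Fdom[].
  - by move=> _ u xu; have [v uv] := Fsurj u xu; exists tt, v.
  - move=> _ u v u' v' uv uv'; have [] := Ford v u v' u' uv uv'.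
    by split.
move=> xy; have [Ffun Fsurj Ford] := heq_iso erefl tT tU Dx Dy xy.
exists (fun uv => [/\ holds (below T x uv.1), holds (below U y uv.2)
                    & heq T U uv.1 uv.2]) => /=.
split; [split|split] => //.
- by move=> u v [].
- by move=> u /Ffun [v [xu yv uv] vP]; exists v.
Qed.

(** * Suslin trees *)

Lemma holds_countable X (A : X -> form groundset) :
  holds (countable A) <-> ctb (fun x => holds (A x)).
Proof.
split=> [/= [F [[_ Ffun] Finj]]|[e eP]].
  have /choice [e eP] x : exists n, holds (A x) -> F (x, n).
    have [Ax|nAx] := pselect (holds (A x)); last by exists 0.
    by have [n [Fn _]] := Ffun x Ax; exists n.
  by exists e => x y /eP Fx /eP Fy xy; apply: Finj Fx _; rewrite xy.
exists (fun xk => holds (A xk.1) /\ xk.2 = e xk.1) => /=; split; [split|].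
- by move=> x y [].
- by move=> x Ax; exists (e x); split=> // z [].
- by move=> x y n [Ax ->] [Ay exy]; apply: eP.
Qed.

(** * Heights in cones *)

Section Cone.

Variables (X : Type) (T : structure groundset X).
Hypothesis treeT : holds (is_tree T).

Lemma cone_tree a : holds (is_tree (cone T a)).
Proof.
split; [|split; [|split]].
- by move=> x [Dx _]; apply: (tree_refl treeT).
- by move=> x y z [Dx _] [Dy _] [Dz _]; apply: (tree_trans treeT).
- by move=> x y [Dx _] [Dy _]; apply: (tree_anti treeT).
- move=> x [Dx _] A AB A0.
  have [|m Am mP] := @tree_min _ _ treeT x A Dx _ A0; last by exists m.
  by move=> y /AB [[Dy _] yx].
Qed.

Lemma cone_below a x u : holds (dom T a) -> holds (dom (cone T a) x) ->
  holds (below (cone T a) x u) <-> holds (below T x u).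
Proof.
move=> Da [Dx xa]; split=> [[[Du _] ux]//|[Du ux]]; split=> //; split=> //.
case: xa => xa; first by left; apply: (tree_trans treeT) xa => //; case: ux.
by apply: (tree_linear_le treeT Dx) => //; case: ux.
Qed.

(** A cone contains all the predecessors of its nodes, so heights do not change. *)
Lemma cone_heq a x : holds (dom T a) -> holds (dom (cone T a) x) ->
  heq (cone T a) T x x.
Proof.
move=> Da Dx; elim/(tree_ind (cone_tree a)): x / Dx => x Dx IH.
by split; constructor=> u xu; exists u => //;
  [apply/(cone_below u Da Dx)|case: (IH u xu)
  |apply/(cone_below u Da Dx)
  |have /(cone_below u Da Dx)/IH[] := xu].
Qed.

Lemma cone_same_height a b x y : holds (dom T a) -> holds (dom T b) ->
  holds (dom (cone T a) x) -> holds (dom (cone T b) y) ->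
  holds (same_height (cone T a) x (cone T b) y) <-> heq T T x y.
Proof.
move=> Da Db xa yb.
have [ta tb] := (cone_tree a, cone_tree b).
have [hx hy] := (cone_heq Da xa, cone_heq Db yb).
have [Dx Dy] : holds (dom T x) /\ holds (dom T y) by case: xa yb => ? _ [].
rewrite holds_same_height //; split=> xy.
  apply: (heq_trans _ _ _ _ (heq_sym hx)) => //.
  exact: heq_trans hy.
apply: (heq_trans _ _ _ _ hx) => //.
exact: (heq_trans _ _ _ _ xy (heq_sym hy)).
Qed.

End Cone.

(** * Levels and derived trees of a normal free Suslin tree *)

Section Suslin.

Variables (S : Type) (leS : S -> S -> Prop).
Let T : structure groundset S := ground leS.
Hypothesis hsuslin : holds (suslin T).
Hypothesis hnormal : holds (normal T).
Hypothesis hfree : holds (free T).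

Notation "x <=h y" := (hle T T x y) (at level 70).
Notation "x =h y" := (heq T T x y) (at level 70).

Lemma ground_tree : holds (is_tree T). Proof. by case: hsuslin. Qed.
Let treeT := ground_tree.

Lemma le_refl x : leS x x. Proof. exact: (tree_refl treeT). Qed.
Lemma le_trans y x z : leS x y -> leS y z -> leS x z.
Proof. exact: (tree_trans treeT). Qed.
Lemma le_anti x y : leS x y -> leS y x -> x = y.
Proof. exact: (tree_anti treeT). Qed.
Lemma le_comparable z x y : leS x z -> leS y z -> leS x y \/ leS y x.
Proof. exact: (tree_linear_le treeT). Qed.
Lemma height_refl x : x <=h x. Proof. exact: (hle_refl treeT). Qed.
Lemma height_trans y x z : x <=h y -> y <=h z -> x <=h z.
Proof. exact: (hle_trans treeT). Qed.
Lemma height_mono x y : leS x y -> x <=h y. Proof. exact: (hle_mono treeT). Qed.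
Lemma eqheight_trans y x z : x =h y -> y =h z -> x =h z.
Proof. exact: (heq_trans treeT treeT). Qed.
Lemma hle_or_ge x y : x <=h y \/ y <=h x. Proof. exact: (hle_or treeT). Qed.

Lemma le_height z x y : leS x z -> leS y z -> x <=h y -> leS x y.
Proof. exact: (hle_le treeT). Qed.

Lemma eq_height z x y : leS x z -> leS y z -> x =h y -> x = y.
Proof.
by move=> xz yz [xy yx]; apply: le_anti; apply: (@le_height z).
Qed.

Lemma restrict g x : g <=h x -> exists2 y, leS y x & g =h y.
Proof.
by move=> gx; have [//|//|y [_ yx] gy] := restriction treeT treeT _ _ gx; exists y.
Qed.

(** Comparable nodes of equal height coincide, so a level is an antichain. *)
Lemma ctb_level g : ctb (fun x => x =h g).
Proof.
case: hsuslin => _ [_ H].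
pose A : groundset S := fun x => x =h g.
suff /holds_countable : holds (countable (fun x => Defs.Mem x A)) by [].
apply: H; right; split=> // x y xg yg /= xy.
by apply: (@eq_height y) => //; [exact: le_refl|exact: eqheight_trans (heq_sym yg)].
Qed.

Lemma ctb_hle g : ctb (fun x => x <=h g).
Proof.
case: hsuslin => _ [[H _] _]; have cg := proj1 (holds_countable (below T g)) (H g I).
apply: (@ctb_sub _ _ (fun x => exists2 y, holds (below T g y) \/ y = g & x =h y)).
  move=> x /restrict [y yg xy]; exists y => //.
  by have [->|ny] := pselect (y = g); [right|left].
apply: ctb_bigcup => [|y _]; last exact: ctb_level.
by apply: ctb_cup => //; exists (fun=> 0) => x y -> ->.
Qed.

(** Otherwise every height occurs among the nodes at most as high as some element of [A]. These are
    countably many, and numbering them would separate all heights by natural numbers, against height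
    [omega_1]. *)
Lemma bound (A : S -> Prop) : ctb A -> exists g, forall x, A x -> x <=h g.
Proof.
move=> cA; apply: contrapT => nb.
have [e eP] : ctb (fun y => exists2 x, A x & y <=h x).
  by apply: ctb_bigcup => // x _; apply: ctb_hle.
have /choice [f fP] g : exists y, (exists2 x, A x & y <=h x) /\ g =h y.
  apply: contrapT => ny; apply: nb; exists g => x Ax.
  have [//|gx] := hle_or_ge x g.
  have [y yx gy] := restrict gx; case: ny; exists y; split=> //.
  by exists x => //; apply: height_mono.
case: hsuslin => _ [[_ H] _]; apply: H.
exists (fun xk => xk.2 = e (f xk.1)) => /=; split; first split=> //.
  by move=> x _; exists (e (f x)).
move=> x y k -> exy; apply/(holds_same_height treeT treeT I I).
have [xf fx] := fP x; have [yf fy] := fP y.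
by apply: eqheight_trans fx _; rewrite (eP _ _ xf yf exy); apply: heq_sym.
Qed.

Lemma bound_fin (J : finType) (f : J -> S) : exists g, forall j, f j <=h g.
Proof.
by have [g gP] := bound (ctb_image f); exists g => j; apply: gP; exists j.
Qed.

Lemma extension x z : x <=h z -> exists2 y, leS x y & y =h z.
Proof.
move=> xz; have [zx|nzx] := pselect (z <=h x).
  by exists x => //; apply: le_refl.
have [//|u zu xu] := hle_total treeT _ nzx.
have [w wu xw] := restrict xu.
case: hnormal => _ [_ [/(_ x z I I) H _]].
case: H => [|y [_ [[xy _] yz]]].
  exists w; split; last exact/(holds_same_height treeT treeT I I).
  have [->//|nwu] := pselect (w = u).
  by apply: (below_trans treeT _ zu).
by exists y => //; apply/(holds_same_height treeT treeT I I).
Qed.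

Definition succ x y := holds (immediate_succ T x y).

Lemma succ_le x y : succ x y -> leS x y.
Proof. by case=> _ [[]]. Qed.

Lemma hle_succ x x' y y' : x <=h x' -> succ x y -> succ x' y' -> y <=h y'.
Proof.
move=> xx' [_ [[xy nxy] ny]] [_ [[xy' nxy'] _]]; constructor=> w [_ [wy nwy]].
exists x'; first by split.
have [wx|xw] := le_comparable wy xy; first exact: height_trans (height_mono wx) xx'.
have [<-//|nxw] := pselect (x = w).
by case: ny; exists w; split=> //; split.
Qed.

Lemma heq_succ x x' y y' : x =h x' -> succ x y -> succ x' y' -> y =h y'.
Proof.
by move=> [xx' x'x] sy sy'; split; [apply: hle_succ sy sy'|apply: hle_succ sy' sy].
Qed.

Lemma two_succ x : exists y z, [/\ succ x y, succ x z & y <> z].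
Proof.
by case: hnormal => _ [/(_ x I) [y [z [sy [sz yz]]]] _]; exists y, z.
Qed.

Lemma derived_dom k (a x : k.-tuple S) : holds (dom (derived T a) x) <->
  (forall i, leS (tnth x i) (tnth a i) \/ leS (tnth a i) (tnth x i)) /\
  (forall i j, tnth x i =h tnth x j).
Proof.
split=> [[xa xx]|[xa xx]].
  split=> [i|i j]; first by case: (xa i).
  by apply/(cone_same_height treeT I I (xa i) (xa j)); apply: xx.
have xa' i : holds (dom (cone T (tnth a i)) (tnth x i)) by split=> //; apply: xa.
split=> [i|i j]; first exact: xa'.
by apply/(cone_same_height treeT I I (xa' i) (xa' j)); apply: xx.
Qed.

Lemma distinct_level k (a : k.-tuple S) :
  holds (distinct_level_tuple T a) <->
  injective (tnth a) /\ forall i j, tnth a i =h tnth a j.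
Proof.
split=> [[_ [ainj aa]]|[ainj aa]].
  split=> [i j aij|i j].
    by apply: contrapT => nij; apply: (ainj i j nij).
  by apply/(holds_same_height treeT treeT I I); apply: aa.
split=> //; split=> [i j nij /ainj //|i j].
by apply/(holds_same_height treeT treeT I I); apply: aa.
Qed.

(** Freeness enters the amalgamation here: after enumerating [Q], the tuple [c] spans a derived tree
    of dimension [#|Q|] in which [A] is an antichain. *)
Lemma ctb_antichain (Q : finType) (c : Q -> S) (A : (Q -> S) -> Prop) :
  0 < #|Q| -> injective c -> (forall q q', c q =h c q') ->
  (forall e, A e -> (forall q, leS (c q) (e q)) /\ forall q q', e q =h e q') ->
  (forall e e', A e -> A e' -> (forall q, leS (e q) (e' q)) -> e = e') ->
  ctb A.
Proof.
move=> Q0 cinj cc Aext Aanti.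
pose tup (e : Q -> S) := [tuple e (enum_val i) | i < #|Q|].
have tupE e i : tnth (tup e) i = e (enum_val i) by rewrite tnth_mktuple.
have tup_inj e e' : tup e = tup e' -> e = e'.
  move=> ee'; apply/funext => q.
  by rewrite -(enum_rankK q) -!tupE ee'.
have [_ [_ H]] : holds (suslin (derived T (tup c))).
  apply: hfree => //; apply/distinct_level; split=> [i j|i j].
    by rewrite !tupE => /cinj /enum_val_inj.
  by rewrite !tupE.
pose B x := exists2 e, A e & x = tup e.
have /holds_countable cB : holds (countable (fun x => Defs.Mem x (B : groundset _))).
  apply: H; right; split=> [_ [e /Aext [ce ee] ->]|].
    apply/derived_dom; split=> [i|i j]; rewrite !tupE //.
    by right.
  move=> _ _ [e Ae ->] [e' Ae' ->] /= ee'; congr tup; apply: Aanti => // q.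
  by have := ee' (enum_rank q); rewrite !tupE enum_rankK.
apply: ctb_preim cB; first by move=> e Ae; exists e.
by move=> e e' _ _; apply: tup_inj.
Qed.

(** * Amalgamation of uncountably many finite systems of nodes *)

Section Amalgamation.

(** The [i]-th system has the nodes [l i j]. Positions in [R] form the root; any other position [j]
    lies above the trace [c (col j)] on the splitting level, and [Q] indexes the distinct traces. *)
Variables (I : Type) (J Q : finType) (l : I -> J -> S).
Variables (R : pred J) (col : J -> Q) (c : Q -> S) (D : I -> Prop).
Hypothesis Q0 : 0 < #|Q|.
Hypothesis c_inj : injective c.
Hypothesis c_level : forall q q', c q =h c q'.
Hypothesis col_surj : forall q, exists2 j, ~~ R j & col j = q.
Hypothesis bigD : big D.
Hypothesis c_le : forall i j, D i -> ~~ R j -> leS (c (col j)) (l i j).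

(** Outside the root all nodes rise above level [g], and those sharing a trace still agree up to
    [g]. At each level only countably many systems fail this, by [stableP]. *)
Let stable g i :=
  (forall j, ~~ R j -> ~ (l i j <=h g)) /\
  (forall j j', ~~ R j -> ~~ R j' -> col j = col j' ->
    exists2 w, g =h w & leS w (l i j) /\ leS w (l i j')).
Hypothesis stableP : forall g, ctb (fun i => D i /\ ~ stable g i).

Let above (e : Q -> S) i := forall j, ~~ R j -> leS (e (col j)) (l i j).
Let ext (e : Q -> S) :=
  (forall q, leS (c q) (e q)) /\ forall q q', e q =h e q'.
Let leQ (e e' : Q -> S) := forall q, leS (e q) (e' q).
Let good e := big (fun i => D i /\ above e i).

Lemma ext_trans e e' : ext e -> leQ e e' -> (forall q q', e' q =h e' q') -> ext e'.
Proof. by move=> [ce _] ee' ?; split=> // q; apply: le_trans (ee' q). Qed.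

(** Stability makes the trace of a node on level [g] depend on its [col] alone, and levels are
    countable, so uncountably many systems share one tuple of traces. *)
Lemma lift g e (E : I -> Prop) : ext e -> (forall q, e q <=h g) ->
  (forall i, E i -> D i /\ above e i) -> big E ->
  exists e', [/\ ext e', leQ e e', forall q, e' q =h g
    & big (fun i => E i /\ above e' i)].
Proof.
move=> ee eg ED bE.
have bE' : big (fun i => E i /\ ~ ~ stable g i).
  by apply: big_minus => //; apply: ctb_sub (stableP g) => i [/ED[]].
have [|i|e' e'g be'] := @big_pigeon _ _ _ (fun f => forall q, f q <=h g)
  (fun i f => (forall q, f q =h g) /\ above f i) bE'.
- exact: ctb_fun (ctb_hle g).
- move=> [Ei /contrapT [hi si]].
  have /choice [f fP] q : exists w, w =h g /\ forall j, ~~ R j -> col j = q ->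
      leS w (l i j).
    have [j nRj jq] := col_surj q.
    have gj : g <=h l i j by have [/(hi j nRj)|] := hle_or_ge (l i j) g.
    have [w wj gw] := restrict gj; exists w; split; first exact: heq_sym.
    move=> j' nRj' j'q; have [|w' gw' [w'j w'j']] := si j j' nRj nRj'.
      by rewrite jq.
    by have -> : w = w' by apply: (eq_height wj w'j); apply: eqheight_trans (heq_sym gw) gw'.
  exists f; first by move=> q; have [[]] := fP q.
  split=> [q|j nRj]; first by case: (fP q).
  by case: (fP (col j)) => _; apply.
have [i [[Ei _] [e'h ae']]] := big_ex be'.
have [Di ae] := ED i Ei.
have lee' : leQ e e'.
  move=> q; have [j nRj jq] := col_surj q.
  have := ae j nRj; have := ae' j nRj; rewrite jq => e'j ej.
  by apply: le_height ej e'j _; apply: height_trans (eg q) _; case: (e'h q).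
exists e'; split=> //.
  apply: ext_trans ee lee' _ => q q'; exact: eqheight_trans (heq_sym (e'h q')).
by apply: big_sub be' => i' [[Ei' _] [_]].
Qed.

Lemma above_le e e' i : leQ e e' -> above e' i -> above e i.
Proof. by move=> ee' ae' j nRj; apply: le_trans (ee' _) (ae' j nRj). Qed.

(** The minimal bad tuples form an antichain of a derived tree of [S], so their
    heights are bounded; a good tuple above that bound has only good
    extensions. *)
Lemma all_good : exists2 e0, ext e0 & forall e, ext e -> leQ e0 e -> good e.
Proof.
apply: contrapT => none.
have bad e0 : ext e0 -> exists2 e, ext e /\ leQ e0 e & ~ good e.
  move=> ee0; apply: contrapT => nb; apply: none; exists e0 => // e ee e0e.
  by apply: contrapT => ng; apply: nb; exists e.
have [q0 _] : exists q0 : Q, true by case/card_gt0P: Q0 => q0; exists q0.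
pose M e := [/\ ext e, ~ good e
  & forall e', ext e' -> ~ good e' -> leQ e' e -> e' = e].
have minM e : ext e -> ~ good e -> exists2 m, M m & leQ m e.
  (* All entries of a tuple have the same height, so a proper step down is proper in every
     coordinate, and induction on one coordinate suffices. *)
  suff: forall x, holds (dom T x) -> forall e, x = e q0 -> ext e -> ~ good e ->
      exists2 m, M m & leQ m e by move/(_ (e q0)); apply.
  move=> {e} x; elim/(tree_ind treeT) => {}x _ IH e xe ee nge.
  have [Me|nMe] := pselect (M e).
    by exists e => // q; apply: le_refl.
  have [e' [ee' nge' e'e] ne'e] : exists2 e', [/\ ext e', ~ good e' & leQ e' e]
      & e' <> e.
    apply: contrapT => nex; apply: nMe; split=> // e' ee' nge' e'e.
    by apply: contrapT => ne'e; apply: nex; exists e'.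
  have [|//|//|m Mm me'] := IH (e' q0) _ e' erefl.
    split=> //; split; first by rewrite xe.
    rewrite /= xe => e'q0; apply: ne'e; apply/funext => q.
    apply: (eq_height (e'e q) (le_refl _)).
    by case: ee ee' => _ ee [_ ee']; apply: eqheight_trans (ee' q q0) _; rewrite e'q0.
  by exists m => // q; apply: le_trans (e'e q).
have cM : ctb M.
  apply: (@ctb_antichain _ c) => // [e []//|e e' [ee nge _] [ee' _ mine']].
  exact: mine'.
have [g gP] : exists g, forall x,
    (exists2 e, M e & exists q, x = e q) \/ (exists q, x = c q) -> x <=h g.
  apply: bound; apply: ctb_cup; last exact: ctb_image.
  by apply: ctb_bigcup => // e _; apply: ctb_image.
(* There are countably many minimal bad tuples, each below countably many systems, so these systems
   can be discarded. *)
pose E i := D i /\ ~ exists2 e, M e & above e i.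
have bE : big E.
  apply: big_minus => //.
  apply: (@ctb_sub _ _ (fun i => exists2 e, M e & D i /\ above e i)).
    by move=> i [Di [e Me ae]]; exists e.
  by apply: ctb_bigcup => // e [_ + _]; apply: contrapT.
have extc : ext c by split=> // q; apply: le_refl.
have [||e' [ee' _ e'g be']] := @lift g c E extc _ _ bE.
- by move=> q; apply: gP; right; exists q.
- by move=> i [Di _]; split=> // j nRj; apply: c_le.
have [e [ee e'e] nge] := bad e' ee'.
(* The height of [m] is at most that of [g], so [m] lies below [e'] and hence below a system kept in
   [E]. *)
have [m Mm me] := minM e ee nge.
have [i [[_ nM] ae']] := big_ex be'; apply: nM; exists m => //.
apply: above_le ae' => q; apply: le_height (me q) (e'e q) _.
apply: (@height_trans g); first by apply: gP; left; exists m => //; exists q.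
by case: (e'g q).
Qed.

(** [K] marks the positions at which the two systems are to be comparable. Outside the root they
    have distinct traces, so the extensions there can be prescribed independently. *)
Variable K : pred J.
Hypothesis K_inj : forall k k', K k -> K k' -> ~~ R k -> ~~ R k' ->
  col k = col k' -> k = k'.

(** Every extension of [e0] lies below uncountably many systems. The first system is taken through
    the successors [y]; the second through [e2], which follows the first on the traces of [K] and
    takes the other successors [z] elsewhere. *)
Lemma amalgamation : exists i1 i2, [/\ D i1, D i2 & i1 <> i2] /\
  [/\ forall k, K k -> ~~ R k -> leS (l i1 k) (l i2 k),
      forall j j', ~~ R j -> ~~ R j' -> ~ (l i2 j' <=h l i1 j),
      forall j j', ~~ R j -> ~~ R j' -> leS (l i1 j) (l i2 j') ->
        exists2 k, K k & col k = col j'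
    & forall a b j j', ~~ R a -> ~~ R b -> ~~ R j -> ~~ R j' ->
        leS (l i1 a) (l i2 j) -> leS (l i1 b) (l i2 j') ->
        l i1 a =h l i1 b -> l i1 a <> l i1 b -> col j <> col j'].
Proof.
have [e0 ee0 gd] := all_good.
have e0h : forall q q', e0 q =h e0 q' by case: ee0.
have /choice [y /choice [z yz]] q := two_succ (e0 q).
pose KQ q := exists k, [/\ K k, ~~ R k & col k = q].
have lvl (s : Q -> S) : (forall q, succ (e0 q) (s q)) -> ext s /\ leQ e0 s.
  move=> sP; have le0 : leQ e0 s by move=> q; apply: succ_le.
  split=> //; apply: ext_trans ee0 le0 _ => q q'.
  exact: heq_succ (e0h q q') (sP q) (sP q').
have [ey e0y] : ext y /\ leQ e0 y by apply: lvl => q; case: (yz q).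
have [ez e0z] : ext z /\ leQ e0 z by apply: lvl => q; case: (yz q).
have yzh q q' : y q =h z q'.
  have [sy _ _] := yz q; have [_ sz _] := yz q'.
  exact: heq_succ (e0h q q') sy sz.
have [i1 [D1 a1]] := big_ex (gd y ey e0y).
(* No node of the first system is higher than [g], so a second system stable at [g] has all its
   nodes outside the root strictly higher. *)
have [g gP] : exists g, forall x : J + Q,
    (match x with inl j => l i1 j | inr q => y q end) <=h g.
  exact: bound_fin.
have /choice [e2 e2P] q : exists w, [/\ w =h g,
    ~ KQ q -> leS (z q) w,
    leS (e0 q) w & forall k, K k -> ~~ R k -> col k = q -> leS (l i1 k) w].
  have [[k [Kk nRk kq]]|nK] := pselect (KQ q).
    have [w kw wg] := extension (gP (inl k)); exists w; split=> //.
    - by case; exists k.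
    - apply: le_trans (e0y q) _; apply: le_trans _ kw.
      by rewrite -kq; apply: a1.
    - move=> k' Kk' nRk' k'q; have -> // : k' = k by apply: K_inj => //; rewrite k'q.
  have [|w zw wg] := @extension (z q) g.
    by apply: height_trans (gP (inr q)); case: (yzh q q).
  exists w; split=> //; first exact: le_trans (e0z q) zw.
  by move=> k Kk nRk kq; case: nK; exists k.
have e02 : leQ e0 e2 by move=> q; case: (e2P q).
have ee2 : ext e2.
  apply: ext_trans ee0 e02 _ => q q'.
  have [qg _ _ _] := e2P q; have [q'g _ _ _] := e2P q'.
  exact: eqheight_trans (heq_sym q'g).
have b2 : big (fun i => (D i /\ above e2 i) /\ ~ (~ stable g i \/ i = i1)).
  apply: big_minus; first exact: gd.
  apply: (@ctb_sub _ _ (fun i => (D i /\ ~ stable g i) \/ i = i1)).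
    by move=> i [[Di _] [ns|->]]; [left|right].
  by apply: ctb_cup => //; exists (fun=> 0) => i i' -> ->.
have [i2 [[D2 a2] /not_orP [/contrapT [h2 s2] ni]]] := big_ex b2.
exists i1, i2; split; first by split=> // i12; apply: ni.
split.
- move=> k Kk nRk; have [_ _ _ /(_ k Kk nRk erefl) kw] := e2P (col k).
  exact: le_trans kw (a2 k nRk).
- move=> j j' nRj nRj' h21; apply: (h2 j' nRj').
  exact: height_trans h21 (gP (inl j)).
- move=> j j' nRj nRj' jj'.
  have jq : col j = col j'.
    apply: c_inj; apply: (@eq_height (l i2 j')); last exact: c_level.
      exact: le_trans (c_le D1 nRj) jj'.
    exact: c_le.
  (* Off the traces of [K], a comparability would put two distinct successors of one node below
     [l i2 j']. *)
  have [[k [Kk _ kq]]|nK] := pselect (KQ (col j')); first by exists k.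
  have [_ /(_ nK) zw _ _] := e2P (col j').
  have [_ _ []] := yz (col j').
  apply: (@eq_height (l i2 j')); last exact: yzh.
    by rewrite -jq; apply: le_trans (a1 j nRj) jj'.
  exact: le_trans zw (a2 j' nRj').
(* If the traces agreed, the two nodes of the second system would agree up to level [g]; both nodes
   of the first would lie below a single [w] and, having equal height, coincide. *)
- move=> a b j j' nRa nRb nRj nRj' aj bj' ab nab jj'.
  have [w gw [wj wj']] := s2 j j' nRj nRj' jj'.
  have w_le d d' : leS (l i1 d) (l i2 d') -> leS w (l i2 d') -> leS (l i1 d) w.
    move=> dd' wd'; apply: le_height dd' wd' _.
    by apply: height_trans (gP (inl d)) _; case: gw.
  by apply: nab; apply: (@eq_height w) => //; apply: w_le; eassumption.
Qed.

End Amalgamation.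

(** Taking [P a z i] to mean that the [z]-th node of [i] is [a] yields the root
    [R] of a Delta-system; taking it to mean that the two nodes indexed by [z]
    split below the level of [a] yields a stable splitting pattern, which makes
    the usual pressing-down argument unnecessary. *)
Lemma saturate (I A : Type) (Z : finType) (P : A -> Z -> I -> Prop) (D : I -> Prop) :
  big D -> exists (R : {set Z}) (E : I -> Prop),
    [/\ forall i, E i -> D i, big E,
        forall z, z \in R -> exists a, forall i, E i -> P a z i
      & forall z a, z \notin R -> ctb (fun i => E i /\ P a z i)].
Proof.
move=> bD.
suff main n (R : {set Z}) (E : I -> Prop) : #|~: R| <= n -> (forall i, E i -> D i) ->
    big E -> (forall z, z \in R -> exists a, forall i, E i -> P a z i) ->
    exists (R' : {set Z}) (E' : I -> Prop),
    [/\ forall i, E' i -> D i, big E',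
        forall z, z \in R' -> exists a, forall i, E' i -> P a z i
      & forall z a, z \notin R' -> ctb (fun i => E' i /\ P a z i)].
  by apply: (main #|~: (set0 : {set Z})| set0 D) => // z; rewrite inE.
elim: n R E => [|n IH] R E; move=> Rn ED bE RE.
  exists R, E; split=> // z a zR; move: Rn; rewrite leqn0 cards_eq0 => /eqP Rn.
  by have : z \in ~: R by [rewrite inE]; rewrite Rn inE.
have [[z [a [zR bza]]]|nz] :=
    pselect (exists z a, z \notin R /\ big (fun i => E i /\ P a z i)); last first.
  exists R, E; split=> // z a zR; apply: contrapT => nc.
  by apply: nz; exists z, a.
apply: (IH (z |: R) (fun i => E i /\ P a z i)) => //.
- by move: Rn; rewrite (cardsD1 z (~: R)) inE zR setCU setIC -setDE.
- by move=> i [/ED].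
- by move=> z' /setU1P [->|/RE [a' a'P]]; [exists a => i []|exists a' => i [/a'P]].
Qed.

Lemma ctb_bigfin (I : Type) (J : finType) (F : J -> I -> Prop) :
  (forall j, ctb (F j)) -> ctb (fun i => exists j, F j i).
Proof.
move=> cF; apply: (@ctb_sub _ _ (fun i => exists2 j, True & F j i)).
  by move=> i [j Fj]; exists j.
by apply: ctb_bigcup => [|j _]; [apply: ctb_countType|apply: cF].
Qed.

(** [R] is the root of the Delta-system, and two nodes outside the root have the
    same [col] when they have the same trace on the splitting level. *)
Lemma separation (I : Type) (J : finType) (l : I -> J -> S) (K : pred J)
    (b : J -> S) (D : I -> Prop) :
  big D ->
  (forall k k', K k -> K k' -> b k =h b k') ->
  (forall k k', K k -> K k' -> b k = b k' -> k = k') ->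
  (forall i k, D i -> K k -> leS (l i k) (b k) \/ leS (b k) (l i k)) ->
  exists i1 i2 (R : pred J) (Q : Type) (col : J -> Q),
  [/\ D i1, D i2, i1 <> i2 & forall j, R j -> l i1 j = l i2 j] /\
  [/\ forall i j j', i = i1 \/ i = i2 -> R j -> ~~ R j' -> ~ (l i j =h l i j'),
      forall k, K k -> leS (l i1 k) (l i2 k),
      forall j j', ~~ R j -> ~~ R j' -> ~ (l i2 j' <=h l i1 j),
      forall j j', ~~ R j -> ~~ R j' -> leS (l i1 j) (l i2 j') ->
        exists2 k, K k & col k = col j'
    & forall a b j j', ~~ R a -> ~~ R b -> ~~ R j -> ~~ R j' ->
        leS (l i1 a) (l i2 j) -> leS (l i1 b) (l i2 j') ->
        l i1 a =h l i1 b -> l i1 a <> l i1 b -> col j <> col j'].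
Proof.
move=> bD bh binj bl.
have [R [D1 [D1D bD1 RD1 nR1]]] := saturate (fun s j i => l i j = s) bD.
(* Second saturation, with levels as parameters: a pair in [pat] fails to agree up to one fixed
   level in every system, while any other pair fails at a given level in only countably many. *)
pose sep g (z : J * J) i := ~ exists2 w, g =h w & leS w (l i z.1) /\ leS w (l i z.2).
have [pat [D2 [D21 bD2 patP npat]]] := saturate sep bD1.
have D2D i : D2 i -> D i by move=> /D21/D1D.
have nR j s : j \notin R -> ctb (fun i => D2 i /\ l i j = s).
  by move=> jR; apply: ctb_sub (nR1 j s jR) => i [/D21].
(* When every position is in the root, the systems coincide node by node and any two distinct
   indices will do. *)
have [allR|[j0 j0R]] : (forall j, j \in R) \/ exists j0, j0 \notin R.
  have [|nall] := pselect (forall j, j \in R); first by left.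
  right; apply: contrapT => nj; apply: nall => j; apply: contrapT => /negP jR.
  by apply: nj; exists j.
  have [i1 D1i1] := big_ex bD1.
  have [i2 [D1i2 ni]] : exists i, D1 i /\ ~ i = i1.
    apply: big_ex; apply: big_minus => //.
    by apply: (@ctb_sub _ _ (fun i => i = i1)) => [i []//|]; exists (fun=> 0) => x y -> ->.
  have l12 j : l i1 j = l i2 j.
    by have [s sP] := RD1 j (allR j); rewrite !sP.
  exists i1, i2, (mem R), J, id; split.
    by split; [exact: D1D|exact: D1D|move=> /esym|].
  split=> [i j j' _ _|k _|j j'|j j'|a a' j j'] /=; rewrite ?allR //.
  by rewrite l12; apply: le_refl.
have [i0 D2i0] := big_ex bD2.
have /choice [r rP] j : exists s, j \in R -> forall i, D2 i -> l i j = s.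
  have [/RD1 [s sP]|_] := boolP (j \in R); last by exists (b j).
  by exists s => _ i /D21; apply: sP.
have /choice [gz gzP] z : exists g, z \in pat -> forall i, D2 i -> sep g z i.
  have [/patP [s sP]|_] := boolP (z \in pat); last by exists (b j0).
  by exists s.
(* The splitting level: at least as high as the root, the tuple [b] and every level recorded for
   [pat]. *)
have [g gP] : exists g, forall x : J + J + (J * J),
    match x with inl (inl j) => r j | inl (inr j) => b j | inr z => gz z end <=h g.
  exact: bound_fin.
pose high g i := forall j, j \notin R -> ~ (l i j <=h g).
have highP h : ctb (fun i => D2 i /\ ~ high h i).
  apply: (@ctb_sub _ _ (fun i => exists j, exists2 s, j \notin R /\ s <=h h
                                    & D2 i /\ l i j = s)).
    move=> i [D2i nh]; apply: contrapT => nex; apply: nh => j jR ljh.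
    by apply: nex; exists j, (l i j).
  apply: ctb_bigfin => j; have [jR|jR] := boolP (j \in R).
    by exists (fun=> 0) => x y [s []].
  apply: ctb_bigcup => [|s _]; last exact: nR.
  by apply: ctb_sub (ctb_hle h) => s [].
have bD3 : big (fun i => D2 i /\ ~ ~ high g i) by apply: big_minus.
have [|i|c' _ bD4] := @big_pigeon _ _ _ (fun f => forall j, f j <=h g)
  (fun i f => forall j, j \notin R -> g =h f j /\ leS (f j) (l i j)) bD3.
- exact: ctb_fun (ctb_hle g).
- move=> [D2i /contrapT hi].
  have /choice [f fP] j : exists s, s <=h g /\
      (j \notin R -> g =h s /\ leS s (l i j)).
    have [jR|jR] := boolP (j \in R); first by exists g; split=> //; apply: height_refl.
    have gl : g <=h l i j by have [|/(hi j jR)] := hle_or_ge g (l i j).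
    have [s sl gs] := restrict gl.
    by exists s; split=> //; case: gs.
  exists f; first by move=> j; case: (fP j).
  by move=> j; case: (fP j).
set D4 := (fun i => _) in bD4.
have D4P i : D4 i -> [/\ D2 i, high g i
    & forall j, j \notin R -> g =h c' j /\ leS (c' j) (l i j)].
  by move=> [[D2i /contrapT hi] ci].
have [i4 /D4P [D2i4 _ c4]] := big_ex bD4.
have c'h j j' : j \notin R -> j' \notin R -> c' j =h c' j'.
  by move=> /c4 [gj _] /c4 [gj' _]; apply: eqheight_trans (heq_sym gj) gj'.
(* Outside the root, [pat] decides exactly which traces on level [g] differ. *)
have pat_c j j' : j \notin R -> j' \notin R -> (j, j') \in pat -> c' j <> c' j'.
  move=> jR j'R jp cc; apply: (gzP _ jp i4 D2i4).
  have [[gcj _] cj] := c4 j jR; have [_ cj'] := c4 j' j'R.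
  have [|w wc gw] := @restrict (gz (j, j')) (c' j).
    exact: height_trans (gP (inr (j, j'))) gcj.
  exists w => //; split; first exact: le_trans wc cj.
  by apply: le_trans wc _; rewrite cc.
have npat_c j j' : j \notin R -> j' \notin R -> (j, j') \notin pat -> c' j = c' j'.
  move=> jR j'R jp.
  have /big_ex [i [/D4P [D2i _ ci] /contrapT [w gw [wj wj']]]] :
      big (fun i => D4 i /\ ~ sep g (j, j') i).
    by apply: big_minus => //; apply: ctb_sub (npat _ g jp) => i [/D4P []].
  have [gcj cj] := ci j jR; have [gcj' cj'] := ci j' j'R.
  rewrite (eq_height cj wj (eqheight_trans (heq_sym gcj) gw)).
  exact: eq_height wj' cj' (eqheight_trans (heq_sym gw) gcj').
(* One representative position per trace, so that the traces become indexed injectively by a finite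
   type. *)
pose rep j := if [pick j' | (j' \notin R) && `[< c' j' = c' j >]] is Some j' then j' else j.
have repP j : j \notin R -> rep j \notin R /\ c' (rep j) = c' j.
  rewrite /rep; case: pickP => [j' /andP[j'R /asboolP]//|/(_ j)] + jR.
  by rewrite jR asboolT.
have rep_eq j j' : j \notin R -> j' \notin R -> c' j = c' j' -> rep j = rep j'.
  move=> jR j'R cc; rewrite /rep cc; case: pickP => // /(_ j').
  by rewrite j'R asboolT.
pose isrep j := (j \notin R) && (rep j == j).
have isrep_rep j : j \notin R -> isrep (rep j).
  move=> jR; have [rR rc] := repP j jR; rewrite /isrep rR /=.
  by apply/eqP; apply: rep_eq.
pose Q : finType := {j : J | isrep j}.
pose q0 : Q := exist _ (rep j0) (isrep_rep j0 j0R).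
pose col j : Q := insubd q0 (rep j).
have colE j : j \notin R -> val (col j) = rep j.
  by move=> jR; rewrite /col val_insubd isrep_rep.
have col_c j j' : j \notin R -> j' \notin R -> col j = col j' -> c' j = c' j'.
  move=> jR j'R /(congr1 val); rewrite !colE // => rr.
  by have [_ <-] := repP j jR; have [_ <-] := repP j' j'R; rewrite rr.
have QR (q : Q) : val q \notin R by case/andP: (valP q).
have [||||||||i1 [i2 [[D4i1 D4i2 ni] [H1 H2 H3 H4]]]] :=
  @amalgamation I J Q l (mem R) col (fun q => c' (val q)) D4 _ _ _ _ _ _ _ K.
- by apply/card_gt0P; exists q0.
- move=> q q' /= /(rep_eq _ _ (QR q) (QR q')).
  case/andP: (valP q) => _ /eqP ->; case/andP: (valP q') => _ /eqP ->.
  exact: val_inj.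
- by move=> q q'; apply: c'h.
- move=> q; exists (val q); first exact: QR.
  apply: val_inj; rewrite colE ?QR //.
  by case/andP: (valP q) => _ /eqP.
- by [].
- move=> i j /D4P [_ _ ci] jR; rewrite colE //.
  by have [_ ->] := repP j jR; case: (ci j jR).
- move=> h; apply: (@ctb_sub _ _ (fun i => (D2 i /\ ~ high h i) \/
      exists z : J * J, z \notin pat /\ (D2 i /\ sep h z i))).
    move=> i [/D4P [D2i _ _] nst]; apply: contrapT => nex; apply: nst; split.
      by move=> j jR lh; apply: nex; left; split=> // hi; apply: (hi j).
    move=> j j' jR j'R jj'; apply: contrapT => nw; apply: nex; right.
    exists (j, j'); split=> //; apply/negP => jp.
    exact: (pat_c _ _ jR j'R jp (col_c _ _ jR j'R jj')).
  apply: ctb_cup => //; apply: ctb_bigfin => z.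
  have [zp|zp] := boolP (z \in pat); first by exists (fun=> 0) => x y [].
  by apply: ctb_sub (npat z h zp) => i [].
(* As [b] lies below the traces, two positions in [K] with one trace have the same value of [b]. *)
- move=> k k' Kk Kk' kR k'R kk'; apply: binj => //.
  have bc j : j \notin R -> K j -> leS (b j) (c' j).
    move=> jR Kj; have [[gc _] cl] := c4 j jR.
    have bgc : b j <=h c' j by apply: height_trans (gP (inl (inr j))) gc.
    have [lb|bl4] := bl i4 j (D2D _ D2i4) Kj; last exact: le_height bl4 cl bgc.
    have cb := le_trans cl lb.
    by rewrite (le_anti cb (le_height (le_refl _) cb bgc)); apply: le_refl.
  apply: (@eq_height (c' k)); [exact: bc| |exact: bh].
  by rewrite (col_c _ _ kR k'R kk'); apply: bc.
have [D2i1 h1 _] := D4P _ D4i1; have [D2i2 h2 _] := D4P _ D4i2.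
have l12 j : j \in R -> l i1 j = l i2 j by move=> jR; rewrite !(rP j jR).
exists i1, i2, (mem R), Q, col; split; first by split=> //; apply: D2D.
split=> //.
- move=> i j j' ii jR j'R [_ jj'].
  have [D2i hi] : D2 i /\ high g i by case: ii => ->.
  by apply: (hi j' j'R); apply: height_trans jj' _; rewrite (rP j jR) //; apply: (gP (inl (inl j))).
- move=> k Kk; have [kR|kR] := boolP (k \in R); last exact: H1.
  by rewrite l12 //; apply: le_refl.
Qed.

End Suslin.

(** * Absoluteness *)

Section Absoluteness.

Variables (P : Type) (leP : P -> P -> Prop).
Hypothesis posetP : forcing_poset leP.

Lemma leP_refl p : leP p p.
Proof. by case: posetP => _ []. Qed.

Lemma leP_trans q p r : leP p q -> leP q r -> leP p r.
Proof. by case: posetP => _ [_ H _]; apply: H. Qed.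

Lemma forces_mono f p q : leP q p -> forces leP p f -> forces leP q f.
Proof.
elim: f p q => [a|X x A|f IH|f IHf g IHg|f IHf g IHg|f IHf g IHg|X f IH|X f IH|X f IH|X f IH] p q qp //=.
- by move=> H s /leP_trans/(_ qp); apply: H.
- by move=> H s /leP_trans/(_ qp); apply: H.
- by case=> ? ?; split; [apply: IHf qp _|apply: IHg qp _].
- by move=> H s /leP_trans/(_ qp); apply: H.
- by move=> H s /leP_trans/(_ qp); apply: H.
- by move=> H x; apply: IH qp _.
- by move=> H s /leP_trans/(_ qp); apply: H.
- by move=> H A; apply: IH qp _.
- by move=> H s /leP_trans/(_ qp); apply: H.
Qed.

Definition absolute (f : form (name P)) (g : form groundset) : Prop :=
  forall p, forces leP p f <-> holds g.

Definition absolute_structure X (Tn : structure (name P) X)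
    (T : structure groundset X) : Prop :=
  (forall x, absolute (dom Tn x) (dom T x)) /\
  (forall x y, absolute (tle Tn x y) (tle T x y)).

Definition check X (A : groundset X) : name P X := fun x _ => A x.

Lemma absolute_ground a : absolute (Ground a) (Ground a).
Proof. by []. Qed.

Lemma absolute_check X (x : X) A : absolute (Defs.Mem x (check A)) (Defs.Mem x A).
Proof.
move=> p; split=> [/(_ p (leP_refl p)) [r [s []]] //|Ax q qp].
by exists q, q; split=> //; apply: leP_refl.
Qed.

Lemma absolute_not f g : absolute f g -> absolute (Not f) (Not g).
Proof.
move=> fg p; split=> [H /fg fp|ng q _ /fg //].
exact: H p (leP_refl p) (fp p).
Qed.

(* Heights are only compared inside the trees, hence the extra hypothesis. *)
Lemma absolute_and f g f' g' :
  absolute f g -> (holds g -> absolute f' g') -> absolute (And f f') (And g g').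
Proof.
move=> fg fg' p; split=> [[/fg hg] /(fg' hg)|[hg hg']] //.
by split; [apply/fg|apply/(fg' hg)].
Qed.

Lemma absolute_or f g f' g' :
  absolute f g -> absolute f' g' -> absolute (Or f f') (Or g g').
Proof.
move=> fg fg' p; split=> [/(_ p (leP_refl p)) [r [_ [/fg|/fg']]]|hg q _].
- by left.
- by right.
- exists q; split; first exact: leP_refl.
  by case: hg => hg; [left; apply/fg|right; apply/fg'].
Qed.

Lemma absolute_imp f g f' g' :
  absolute f g -> absolute f' g' -> absolute (Imp f f') (Imp g g').
Proof.
move=> fg fg' p; split=> [H hg|H q _ /(fg q) hg].
  by apply/(fg' p); apply: (H p (leP_refl p)); apply/fg.
by apply/(fg' q); apply: H.
Qed.

Lemma absolute_all X (f : X -> form (name P)) g :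
  (forall x, absolute (f x) (g x)) -> absolute (All f) (All g).
Proof. by move=> fg p; split=> H x; apply/fg; apply: H. Qed.

Lemma absolute_ex X (f : X -> form (name P)) g :
  (forall x, absolute (f x) (g x)) -> absolute (Ex f) (Ex g).
Proof.
move=> fg p; split=> [/(_ p (leP_refl p)) [r [_ [x /fg hx]]]|[x hx] q _].
  by exists x.
by exists q; split; [apply: leP_refl|exists x; apply/fg].
Qed.

(** The check name of a ground-model witness serves. This is one direction only, since a witness in
    the extension need not come from V. *)
Lemma forces_exset X (f : name P X -> form (name P)) g :
  (forall A, absolute (f (check A)) (g A)) -> holds (ExSet g) ->
  forall p, forces leP p (ExSet f).
Proof.
move=> fg [A hA] p q _; exists q; split; first exact: leP_refl.
by exists (check A); apply/fg.
Qed.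

Lemma absolute_function X Y An A Bn B (F : groundset (X * Y)) :
  (forall x, absolute (An x) (A x)) -> (forall y, absolute (Bn y) (B y)) ->
  absolute (is_function An Bn (check F)) (is_function A B F).
Proof.
move=> hA hB; apply: absolute_and => [|_].
  do 2!apply: absolute_all => ?; apply: absolute_imp; first exact: absolute_check.
  by apply: absolute_and.
apply: absolute_all => x; apply: absolute_imp => //; apply: absolute_ex => y.
apply: absolute_and => [|_]; first exact: absolute_check.
apply: absolute_all => z; apply: absolute_imp; first exact: absolute_check.
exact: absolute_ground.
Qed.

Lemma forces_countable X An (A : X -> form groundset) p :
  (forall x, absolute (An x) (A x)) -> holds (countable A) ->
  forces leP p (countable An).
Proof.
move=> hA cA; apply: (forces_exset _ cA) => F.
apply: absolute_and => [|_].
  by apply: absolute_function => // n; apply: absolute_ground.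
do 3!apply: absolute_all => ?; do 2!(apply: absolute_imp; first exact: absolute_check).
exact: absolute_ground.
Qed.

(** An enumeration in V of all possible members of [A] restricts to one of [A]; its name attaches to
    each pair the conditions that put the first entry into [A]. *)
Lemma forces_countable_mem X (A : name P X) r :
  ctb (fun x => exists2 s, leP s r & forces leP s (Defs.Mem x A)) ->
  exists F : name P (X * nat),
    forces leP r (is_function (fun x => Defs.Mem x A) (fun _ => Ground True) F /\
      FORALL x y n, Defs.Mem (x, n) F --> Defs.Mem (y, n) F -->
        Ground (x = y))%form.
Proof.
move=> [e eP]; pose F : name P (X * nat) := fun xk q => xk.2 = e xk.1 /\ A xk.1 q.
have FP q x k : forces leP q (Defs.Mem (x, k) F) <->
    k = e x /\ forces leP q (Defs.Mem x A).
  split=> [H|[-> H] q' q'q].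
    split=> [|q' /H [r' [s [r'q' [_ As] r's]]]]; last by exists r', s.
    by have [r' [s [_ [/= -> _] _]]] := H q (leP_refl q).
  by have [r' [s [r'q' As r's]]] := H q' q'q; exists r', s.
exists F; split; [split|].
- by move=> x k q qr /FP [].
- move=> x q qr Ax q' q'q; exists q'; split; first exact: leP_refl.
  exists (e x); split; first by apply/FP; split=> //; exact: (@forces_mono (Defs.Mem x A) q).
  by move=> k s _ /FP [].
- move=> x y k q qr /FP [-> Ax] q' q'q /FP [exy Ay].
  apply: eP => //; first by exists q.
  by exists q' => //; apply: leP_trans qr.
Qed.

(** * Well-foundedness and height of absolute trees in the extension *)

Section Structure.

Variables (X : Type) (Tn : structure (name P) X) (T : structure groundset X).
Hypothesis absT : absolute_structure Tn T.
Hypothesis treeT : holds (is_tree T).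

Lemma absolute_tlt x y : absolute (tlt Tn x y) (tlt T x y).
Proof.
apply: absolute_and => [|_]; first exact: (proj2 absT).
by apply: absolute_not; apply: absolute_ground.
Qed.

Lemma absolute_below x y : absolute (below Tn x y) (below T x y).
Proof.
by apply: absolute_and => [|_]; [apply: (proj1 absT)|apply: absolute_tlt].
Qed.

(** The order axioms are absolute. For a name [A] of a set of predecessors, the least possible
    member is found in V; a condition forcing it into [A] makes it the least element of [A]. *)
Lemma forces_tree p : forces leP p (is_tree Tn).
Proof.
have [absD absL] := absT; have [Trefl [Ttrans [Tanti _]]] := treeT.
split; [|split; [|split]].
- have H : absolute (FORALL x, dom Tn x --> tle Tn x x)%form
                    (FORALL x, dom T x --> tle T x x)%form.
    by apply: absolute_all => x; apply: absolute_imp.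
  exact/H.
- have H : absolute (FORALL x y z, dom Tn x --> dom Tn y --> dom Tn z -->
      tle Tn x y --> tle Tn y z --> tle Tn x z)%form
      (FORALL x y z, dom T x --> dom T y --> dom T z -->
      tle T x y --> tle T y z --> tle T x z)%form.
    by do 3!apply: absolute_all => ?; do 5!apply: absolute_imp => //.
  exact/H.
- have H : absolute (FORALL x y, dom Tn x --> dom Tn y -->
      tle Tn x y --> tle Tn y x --> Ground (x = y))%form
      (FORALL x y, dom T x --> dom T y -->
      tle T x y --> tle T y x --> Ground (x = y))%form.
    by do 2!apply: absolute_all => ?; do 4!apply: absolute_imp => //.
  exact/H.
move=> x q0 q0p /absD Dx A q1 q10 AB q2 q21 A0 q3 q32.
pose B y := exists2 s, leP s q3 & forces leP s (Defs.Mem y A).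
have Bx y : B y -> holds (below T x y).
  move=> [s sq3 As]; apply/absolute_below; apply: AB As.
  by apply: leP_trans q21; apply: leP_trans q32.
have [|m [r rq3 Am] mP] := tree_min treeT (A := B) Dx Bx.
  by have [r [rq3 [y Ay]]] := A0 q3 q32; exists y, r.
exists r; split=> //; exists m; split=> // y s sr Ay; apply/absL; apply: mP.
by exists s => //; apply: leP_trans rq3.
Qed.

(** A name for a map separating the heights has, for each value [k], only
    countably many heights of possible preimages, by the chain condition. *)
Lemma forces_height_omega1 p : ccc leP -> holds (height_omega1 T) ->
  (forall x y q, holds (dom T x) -> holds (dom T y) ->
     forces leP q (same_height Tn x Tn y) -> heq T T x y) ->
  forces leP p (height_omega1 Tn).
Proof.
move=> cccP [cT hT] shT; have [absD absL] := absT; split.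
  move=> x q _ /absD Dx; apply: (@forces_countable X (below Tn x) (below T x) q _ (cT x Dx)).
  by move=> y; apply: absolute_below.
move=> q _ /(_ q (leP_refl q)) [r [_ [F [[Fdom Ffun] Fsep]]]]; apply: hT.
pose V k x := holds (dom T x) /\
  exists2 s, leP s r & forces leP s (Defs.Mem (x, k) F).
pose cls x : X -> Prop := fun y => holds (dom T y) /\ heq T T x y.
have clsE x y : holds (dom T x) -> holds (dom T y) -> heq T T x y -> cls x = cls y.
  move=> Dx Dy xy; apply/funext => z; apply/propext.
  split=> -[Dz h]; split=> //; apply: (heq_trans treeT treeT) h => //.
  exact: heq_sym.
(* The condition is chosen from the height class of [x], not from [x], so nodes of equal height get
   the same one and distinct chosen conditions for one [k] are incompatible. *)
have [ch chP] : exists ch : nat -> (X -> Prop) -> P, forall k x, V k x ->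
    leP (ch k (cls x)) r /\
      exists2 y, cls x y &
      forces leP (ch k (cls x)) (Defs.Mem (y, k) F).
  have /choice [ch chP] (kC : nat * (X -> Prop)) : exists s : P,
      (exists x, V kC.1 x /\ kC.2 = cls x) ->
      leP s r /\ exists2 y, kC.2 y & forces leP s (Defs.Mem (y, kC.1) F).
    case: kC => k C /=.
    have [[x [[Dx [s sr sx]] ->]]|nx] := pselect (exists x, V k x /\ C = cls x).
      by exists s => _; split=> //; exists x => //; split=> //; apply: (heq_refl treeT).
    by exists r => /nx.
  exists (fun k C => ch (k, C)) => k x Vx; apply: (chP (k, cls x)).
  by exists x.
have same k x y : V k x -> V k y -> compatible leP (ch k (cls x)) (ch k (cls y)) ->
    heq T T x y.
  move=> Vx Vy [s [sx sy]].
  have [xr [x' [Dx' xx'] Fx']] := chP _ _ Vx.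
  have [_ [y' [Dy' yy'] Fy']] := chP _ _ Vy.
  have x'y' : heq T T x' y'.
    apply: (shT _ _ s) => //; apply: (Fsep x' y' k s (leP_trans sx xr)).
      exact: forces_mono Fx'.
    apply: leP_refl.
    exact: forces_mono Fy'.
  have [[Dx _] [Dy _]] := (Vx, Vy).
  apply: (heq_trans treeT treeT) (heq_sym yy') => //.
  exact: (heq_trans treeT treeT) xx' x'y'.
have /choice [e eP] k : exists e : P -> nat, forall x y, V k x -> V k y ->
    e (ch k (cls x)) = e (ch k (cls y)) -> heq T T x y.
  have [|e eP] := cccP (fun s => exists2 x, V k x & s = ch k (cls x)).
    move=> _ _ [x Vx ->] [y Vy ->] ne xy; apply: ne.
    by rewrite (clsE x y) //; [case: Vx|case: Vy|apply: same xy].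
  exists e => x y Vx Vy exy; apply: same (Vx) (Vy) _.
  rewrite (eP _ _ _ _ exy); [|by exists x|by exists y].
  by exists (ch k (cls y)); split; apply: leP_refl.
have /choice [kf kfP] x : exists k, holds (dom T x) -> V k x.
  have [Dx|nDx] := pselect (holds (dom T x)); last by exists 0.
  have [s [sr [k [Fk _]]]] := Ffun x r (leP_refl r) (proj2 (absD x r) Dx) r (leP_refl r).
  by exists k => _; split=> //; exists s.
(* The code records a possible value at [x] and the number of the chosen condition in the countable
   antichain for that value. *)
exists (fun xk => holds (dom T xk.1) /\
   xk.2 = pickle (kf xk.1, e (kf xk.1) (ch (kf xk.1) (cls xk.1)))) => /=.
split; [split|].
- by move=> x k [].
- by move=> x Dx; eexists; split; [split=> //|move=> z []].
move=> x y k [Dx ->] [Dy /(pcan_inj (@pickleK _)) [kxy exy]].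
apply/(holds_same_height treeT treeT Dx Dy).
apply: (eP (kf x)); [exact: kfP|by rewrite kxy; apply: kfP|].
by rewrite exy kxy.
Qed.

End Structure.

(** An isomorphism in the extension need not lie in V, but the pairs forced into it by conditions
    below [r] satisfy [iso_hle], which compares the heights in V. *)
Lemma forces_same_height X Y (Tn : structure (name P) X)
    (T : structure groundset X) (Un : structure (name P) Y)
    (U : structure groundset Y) x y :
  absolute_structure Tn T -> absolute_structure Un U ->
  holds (is_tree T) -> holds (is_tree U) ->
  holds (dom T x) -> holds (dom U y) ->
  absolute (same_height Tn x Un y) (same_height T x U y).
Proof.
move=> aT aU tT tU Dx Dy p; split; last first.
  move=> h; apply: (forces_exset _ h) => F.
  apply: absolute_and => [|_].
    by apply: absolute_function => ?; apply: absolute_below.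
  apply: absolute_and => [|_].
    apply: absolute_all => v; apply: absolute_imp; first exact: absolute_below.
    by apply: absolute_ex => u; apply: absolute_check.
  do 4!apply: absolute_all => ?; do 2!(apply: absolute_imp; first exact: absolute_check).
  by apply: absolute_and => [|_]; apply: absolute_imp;
    (exact: (proj2 aT) || exact: (proj2 aU)).
move=> /(_ p (leP_refl p)) [r [_ [F [[Fdom Ffun] [Fsurj Ford]]]]].
apply/(holds_same_height tT tU Dx Dy).
pose W := {q | leP q r}.
pose leW (q q' : W) := leP (sval q) (sval q').
pose w0 : W := exist _ r (leP_refl r).
pose G (q : W) u v := forces leP (sval q) (Defs.Mem (u, v) F).
have Gmono q q' u v : leW q' q -> G q u v -> G q' u v by apply: forces_mono.
have Gdom q u v : G q u v -> holds (below T x u) /\ holds (below U y v).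
  move=> /(Fdom u v (sval q) (proj2_sig q)) [].
  by move=> /(absolute_below aT) ? /(absolute_below aU).
have Gord q u v u' v' : G q u v -> G q u' v' ->
    (holds (tle T u u') <-> holds (tle U v v')).
  move=> uv uv'.
  have [H1 H2] := Ford u v u' v' _ (proj2_sig q) uv _ (leP_refl _) uv'.
  have [[_ aT'] [_ aU']] := (aT, aU).
  split=> [/(aT' u u' (sval q))/(H1 _ (leP_refl _))/aU'//|].
  by move=> /(aU' v v' (sval q))/(H2 _ (leP_refl _))/aT'.
split.
  apply: (@iso_hle _ _ _ _ _ _ W leW G w0) => // -[q qr] u.
  move=> /(absolute_below aT x u q) /(Ffun u q qr) /(_ q (leP_refl q)).
  by move=> [s [sq [v [Fv _]]]]; exists (exist _ s (leP_trans sq qr)), v.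
apply: (@iso_hle _ _ _ _ _ _ W leW (fun q v u => G q u v) w0) => //.
- by move=> q q' u v; apply: Gmono.
- by move=> q u v /Gdom [].
- move=> [q qr] v /(absolute_below aU y v q) /(Fsurj v q qr) /(_ q (leP_refl q)).
  by move=> [s [sq [u Fu]]]; exists (exist _ s (leP_trans sq qr)), u.
- by move=> q u v u' v' uv uv'; have [] := Gord _ _ _ _ _ uv uv'; split.
Qed.

End Absoluteness.

(** * The forcing poset *)

Definition finite_pred (X : Type) (f : X -> Prop) : Prop :=
  exists L (w : 'I_L -> X), forall x, f x <-> exists a, w a = x.

Lemma finite_cup X (f g : X -> Prop) : finite_pred f -> finite_pred g -> finite_pred (fun x => f x \/ g x).
Proof.
move=> [L [w wP]] [L' [w' wP']].
exists (L + L'), (fun a => match split a with inl b => w b | inr b => w' b end).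
move=> x; rewrite wP wP'; split=> [[[a <-]|[a <-]]|[a <-]].
- by exists (unsplit (inl a)); rewrite unsplitK.
- by exists (unsplit (inr a)); rewrite unsplitK.
- by case: (split a) => b; [left|right]; exists b.
Qed.

Section Poset.

Variables (S : Type) (leS : S -> S -> Prop).
Let T : structure groundset S := ground leS.
Hypothesis hsuslin : holds (suslin T).
Hypothesis hnormal : holds (normal T).
Hypothesis hfree : holds (free T).
Variable n : nat.

Definition leT m (u v : m.-tuple S) := forall i, leS (tnth u i) (tnth v i).

Lemma leT_refl m (u : m.-tuple S) : leT u u.
Proof. by move=> i; apply: le_refl hsuslin _. Qed.

Definition node (u : n.+1.-tuple S) :=
  injective (tnth u) /\ forall i j, heq T T (tnth u i) (tnth u j).

Definition condition (f : n.+1.-tuple S * nat -> Prop) :=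
  [/\ finite_pred f,
      forall u k, f (u, k) -> node u,
      forall u k k', f (u, k) -> f (u, k') -> k = k'
    & forall u v k, f (u, k) -> f (v, k) -> leT u v -> u = v].

Definition cond := {f | condition f}.

Definition extends (q p : cond) := forall x, sval p x -> sval q x.

Lemma extends_poset : forcing_poset extends.
Proof.
split.
  have c0 : condition (fun _ => False).
    split=> //; exists 0, (fun a : 'I_0 => False_rect _ (notF (ltn_ord a))) => x.
    by split=> // -[[]].
  exact: inhabits (exist _ _ c0).
split=> [p x //|p q r pq qr x /qr/pq //|[p cp] [q cq] pq qp].
have pqE : p = q.
  by apply/funext => x; apply/propext; split; [apply: qp|apply: pq].
by subst q; congr exist; apply: Prop_irrelevance.
Qed.

(** With [K] set, the tuples [x i] become comparable, and [m <= n] leaves no room for a conflict;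
    this serves names of antichains. With [K] unset they are kept apart, which serves names of
    chains and the chain condition. *)
Lemma compatible_amalgam (I : Type) m (p : I -> cond) (x : I -> m.-tuple S)
    (K : bool) (b : m.-tuple S) (D : I -> Prop) : big D ->
  (K -> [/\ m <= n, injective (tnth b),
            forall i j, heq T T (tnth b i) (tnth b j)
          & forall i j, D i ->
              leS (tnth (x i) j) (tnth b j) \/ leS (tnth b j) (tnth (x i) j)]) ->
  exists i1 i2, [/\ D i1, D i2, i1 <> i2, compatible extends (p i1) (p i2)
    & if K then leT (x i1) (x i2)
      else forall j, leS (tnth (x i1) j) (tnth (x i2) j) \/
                     leS (tnth (x i2) j) (tnth (x i1) j) ->
                     tnth (x i1) j = tnth (x i2) j].
Proof.
move=> bD HK.
have [|i|L _ bD1] := @big_pigeon _ _ _ (fun _ : nat => True)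
  (fun i L => exists w : 'I_L -> _, forall x, sval (p i) x <-> exists a, w a = x) bD.
- exact: ctb_countType.
- by move=> _; case: (p i) => f [[L fL] _ _ _] /=; exists L.
have [i0 [_ [w0 _]]] := big_ex bD1.
have /choice [w wP] i : exists w : 'I_L -> n.+1.-tuple S * nat,
    (D i /\ exists w : 'I_L -> n.+1.-tuple S * nat,
       forall x, sval (p i) x <-> exists a, w a = x) ->
    forall x, sval (p i) x <-> exists a, w a = x.
  have [[w wP]|nw] := pselect (exists w : 'I_L -> n.+1.-tuple S * nat,
       forall x, sval (p i) x <-> exists a, w a = x); first by exists w.
  by exists w0 => -[_ /nw].
(* After this thinning the value depends on the position only, so a tuple in the root gets the same
   value from both conditions. *)
have [||lab _ bD2] := @big_pigeon _ _ _ (fun _ : 'I_L -> nat => 'I_L -> True)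
  (fun i lab => forall a, (w i a).2 = lab a) bD1.
- by apply: (@ctb_fun _ _ (fun _ : nat => True)); apply: ctb_countType.
- by move=> i _; exists (fun a => (w i a).2).
set D2 := (fun i => _) in bD2.
have D2P i : D2 i -> [/\ D i, forall x, sval (p i) x <-> exists a, w i a = x
    & forall a, (w i a).2 = lab a].
  by move=> [D1i labi]; split=> //; [case: D1i|apply: wP].
pose J : finType := ('I_L * 'I_n.+1 + 'I_m)%type.
pose l i (j : J) := match j with inl z => tnth (w i z.1).1 z.2 | inr t => tnth (x i) t end.
pose KJ : pred J := fun j => if j is inr _ then K else false.
have [i3 _] := big_ex bD2.
pose bJ (j : J) := match j with inl _ => l i3 j | inr t => tnth b t end.
have [|||i1 [i2 [R [Q [col [[D21 D22 ni R12] [RR HKK low pred_col dist]]]]]]] :=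
  @separation _ _ hsuslin hnormal hfree I J l KJ bJ D2 bD2.
- move=> [//|k] [//|k'] /= /HK [_ _ bh _] _.
  exact: bh.
- move=> [//|k] [//|k'] /= /HK [_ binj _ _] _.
  by move/binj => ->.
- move=> i [//|k] /D2P [Di _ _] /= /HK [_ _ _ bl].
  exact: bl.
have [D1 w1P lab1] := D2P _ D21; have [D2' w2P lab2] := D2P _ D22.
have nd i a : D2 i -> node (w i a).1.
  move=> /D2P [_ wiP _]; have : sval (p i) (w i a) by apply/wiP; exists a.
  by case: (p i) => f [_ fn _ _] /=; case: (w i a) => u k; apply: fn.
(* Root and non-root nodes differ in height while a tuple has a single height, so a tuple lies in
   the root entirely or not at all. *)
have Rall i a t t' : i = i1 \/ i = i2 -> R (inl (a, t)) -> R (inl (a, t')).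
  move=> ii Rt; apply: contrapT => /negP nRt; apply: (RR i _ _ ii Rt nRt).
  by have [|_] := nd i a; [case: ii => ->|apply].
have Rw a t : R (inl (a, t)) -> w i1 a = w i2 a.
  move=> Rt; rewrite (surjective_pairing (w i1 a)) (surjective_pairing (w i2 a)).
  rewrite lab1 lab2; congr pair; apply: eq_from_tnth => t'.
  by apply: (R12 (inl (a, t'))); apply: Rall Rt; left.
(* A comparability would send the [n.+1] coordinates to coordinates of [x], injectively because the
   entries of the lower tuple are distinct; but there are only [m <= n] of those. *)
have nle a a' t t' : ~~ R (inl (a, t)) -> ~~ R (inl (a', t')) ->
    leT (w i1 a).1 (w i2 a').1 -> False.
  move=> nRt nRt' le12.
  have nRa s : ~~ R (inl (a, s)) by apply: contra nRt; apply: Rall; left.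
  have nRa' s : ~~ R (inl (a', s)) by apply: contra nRt'; apply: Rall; left.
  have /choice [s sP] t0 : exists s : 'I_m, K /\ col (inr s) = col (inl (a', t0)).
    have [[//|s] /= Ks cs] := pred_col (inl (a, t0)) (inl (a', t0)) (nRa t0) (nRa' t0) (le12 t0).
    by exists s.
  have s_inj : injective s.
    move=> t1 t2 st; apply: contrapT => nt.
    have [inj1 h1] := nd i1 a D21.
    apply: (dist (inl (a, t1)) (inl (a, t2)) (inl (a', t1)) (inl (a', t2))) => //=.
    - by move/inj1.
    - by have [_ <-] := sP t1; have [_ <-] := sP t2; rewrite st.
  have [KT _] := sP ord0; have [mn _ _ _] := HK KT.
  have := leq_card s s_inj; rewrite !card_ord => nm.
  by have := leq_trans nm mn; rewrite ltnn.
have nge a a' t t' : ~~ R (inl (a, t)) -> ~~ R (inl (a', t')) ->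
    leT (w i2 a').1 (w i1 a).1 -> False.
  move=> nRt nRt' le21.
  have nRa' s : ~~ R (inl (a', s)) by apply: contra nRt'; apply: Rall; left.
  apply: (low _ _ nRt (nRa' t)).
  by apply: (height_mono hsuslin); apply: le21.
have cross u k v k' : sval (p i1) (u, k) -> sval (p i2) (v, k') ->
    [\/ sval (p i2) (u, k), sval (p i1) (v, k') | ~ leT u v /\ ~ leT v u].
  move=> /w1P [a wa] /w2P [a' wa'].
  have [Ra|nRa] := boolP (R (inl (a, ord0))).
    by constructor 1; apply/w2P; exists a; rewrite -(Rw _ _ Ra).
  have [Ra'|nRa'] := boolP (R (inl (a', ord0))).
    by constructor 2; apply/w1P; exists a'; rewrite (Rw _ _ Ra').
  constructor 3; split=> h.
    by apply: (nle _ _ _ _ nRa nRa'); rewrite wa wa'.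
  by apply: (nge _ _ _ _ nRa nRa'); rewrite wa wa'.
have cup_cond : condition (fun y => sval (p i1) y \/ sval (p i2) y).
  have [f1 n1 u1 a1] := proj2_sig (p i1).
  have [f2 n2 u2 a2] := proj2_sig (p i2).
  split.
  - exact: finite_cup.
  - by move=> u k [/n1|/n2].
  - move=> u k k' [h|h] [h'|h']; [exact: u1 h h'| | |exact: u2 h h'].
      have [g|g|[[]]] := cross _ _ _ _ h h'; [exact: u2 g h'|exact: u1 h g|].
      exact: leT_refl.
    have [g|g|[[]]] := cross _ _ _ _ h' h; [exact: u2 h g|exact: u1 g h'|].
    exact: leT_refl.
  - move=> u v k [h|h] [h'|h'] uv; [exact: a1 h h' uv| | |exact: a2 h h' uv].
      by have [g|g|[]//] := cross _ _ _ _ h h'; [exact: a2 g h' uv|exact: a1 h g uv].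
    by have [g|g|[]//] := cross _ _ _ _ h' h; [exact: a2 h g uv|exact: a1 g h' uv].
exists i1, i2; split=> //.
  by exists (exist _ _ cup_cond); split=> y /=; [left|right].
case: (boolP K) => [Kt t|/negP nK t h]; first exact: (HKK (inr t)).
have nKJ (j : J) : ~ KJ j by case: j. have [Rt|nRt] := boolP (R (inr t)); first exact: (R12 (inr t)).
case: h => h.
  by have [j /nKJ] := pred_col (inr t) (inr t) nRt nRt h.
by case: (low (inr t) (inr t) nRt nRt); apply: (height_mono hsuslin).
Qed.

Lemma extends_ccc : ccc extends.
Proof.
move=> A anti; apply: contrapT => bA.
have [//|p [q [Ap Aq pq pqc _]]] :=
  @compatible_amalgam cond 0 id (fun _ => [tuple]) false [tuple] A bA.
exact: anti Ap Aq pq pqc.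
Qed.

Lemma extends_dense (p : cond) u : node u ->
  exists2 q, extends q p & exists k, sval q (u, k).
Proof.
move=> nu; have [[k pk]|nk] := pselect (exists k, sval p (u, k)).
  by exists p => //; exists k.
have [fp np up ap] := proj2_sig p.
have [L [w wP]] := fp.
(* One more than every value in use, so no comparable tuple can clash with it. *)
pose k := (\max_(a < L) (w a).2).+1.
have fresh v k' : sval p (v, k') -> k' <> k.
  move=> /wP [a wa] k'k; have := leq_bigmax (F := fun a => (w a).2) a.
  by rewrite wa /= k'k ltnn.
have c : condition (fun y => sval p y \/ y = (u, k)).
  split.
  - apply: finite_cup => //; exists 1, (fun=> (u, k)) => y.
    by split=> [->|[_ <-]//]; exists ord0.
  - by move=> v k' [/np//|[-> _]].
  - move=> v k1 k2 [h|e] [h'|e'].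
    + exact: up h h'.
    + by case: e' => vu _; case: nk; exists k1; rewrite -vu.
    + by case: e => vu _; case: nk; exists k2; rewrite -vu.
    + by case: e e' => _ -> [_ ->].
  - move=> v v' k' [h|e] [h'|e'] vv'.
    + exact: ap h h' vv'.
    + by case: e' => _ k'k; case: (fresh _ _ h).
    + by case: e => _ k'k; case: (fresh _ _ h').
    + by case: e e' => -> _ [-> _].
by exists (exist _ _ c) => [y|]; [left|exists k; right].
Qed.

Let Tn : structure (name cond) S := ground leS.
Let treeT : holds (is_tree T) := ground_tree hsuslin.

Lemma absolute_cone (a : S) :
  absolute_structure extends (cone Tn a) (cone T a).
Proof.
split=> [x|x y]; last exact: absolute_ground.
apply: absolute_and => [|_]; first exact: absolute_ground.
by apply: (absolute_or extends_poset); apply: absolute_ground.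
Qed.

Lemma absolute_derived m (a : m.-tuple S) :
  absolute_structure extends (derived Tn a) (derived T a).
Proof.
split=> [x|x y]; last by apply: absolute_all => i; apply: absolute_ground.
apply: absolute_and => [|xa].
  by apply: absolute_all => i; apply: (proj1 (absolute_cone _)).
apply: absolute_all => i; apply: absolute_all => j.
by apply: (forces_same_height extends_poset); try exact: absolute_cone;
  try (exact: cone_tree); apply: xa.
Qed.

Lemma absolute_distinct m (a : m.-tuple S) :
  absolute extends (distinct_level_tuple Tn a) (distinct_level_tuple T a).
Proof.
have abs0 b : absolute extends (Ground b) (Ground b) by apply: absolute_ground.
apply: absolute_and => [|_]; first by apply: absolute_all => i.
apply: absolute_and => [|_]; apply: absolute_all => i; apply: absolute_all => j.
  by apply: (absolute_imp extends_poset); apply: (absolute_not extends_poset).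
by apply: (forces_same_height extends_poset).
Qed.

(** * Derived trees in the extension *)

Section Derived.

Variables (m : nat) (a : m.-tuple S).
Hypothesis m0 : 0 < m.
Hypothesis da : holds (distinct_level_tuple T a).

Let derived_suslin : holds (suslin (derived T a)) := hfree m0 da.
Let derived_tree : holds (is_tree (derived T a)) := proj1 derived_suslin.

Lemma forces_derived_tree p : forces extends p (is_tree (derived Tn a)).
Proof. exact: (forces_tree extends_poset (absolute_derived a)). Qed.

Lemma forces_derived_height p : forces extends p (height_omega1 (derived Tn a)).
Proof.
apply: (forces_height_omega1 extends_poset (absolute_derived a) derived_tree).
- exact: extends_ccc.
- by case: derived_suslin => _ [].
- move=> x y q Dx Dy xy; apply/(holds_same_height derived_tree derived_tree Dx Dy).
  exact: (proj1 (forces_same_height extends_poset (absolute_derived a)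
    (absolute_derived a) derived_tree derived_tree Dx Dy q) xy).
Qed.

Lemma derived_eq x y (i : 'I_m) : holds (dom (derived T a) x) ->
  holds (dom (derived T a) y) -> leT x y -> tnth x i = tnth y i -> x = y.
Proof.
move=> /(derived_dom hsuslin) [_ xx] /(derived_dom hsuslin) [_ yy] xy xyi.
apply: eq_from_tnth => j; apply: (eq_height hsuslin (xy j) (le_refl hsuslin _)).
by apply: (eqheight_trans hsuslin (xx j i)); rewrite xyi; apply: yy.
Qed.

(** If a name [A] had uncountably many possible members, each with a condition forcing it into [A],
    two of these conditions would be compatible for distinct members that are incomparable when [A]
    is a chain, and comparable when it is an antichain. *)
Lemma forces_derived_suslin p : m <= n -> forces extends p (suslin (derived Tn a)).
Proof.
move=> mn; split; first exact: forces_derived_tree.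
split; first exact: forces_derived_height.
have [absD absL] := absolute_derived a.
have [ainj ah] := proj1 (distinct_level hsuslin a) da.
move=> A q _ chainA q1 q1q; have [r [rq1 rA]] := chainA q1 q1q.
exists r; split=> //; apply: (forces_countable_mem extends_poset).
apply: contrapT => bX.
pose X x := exists2 s, extends s r & forces extends s (Defs.Mem x A).
have domX x : X x -> holds (dom (derived T a) x).
  move=> [s sr sA]; apply/(absD x s).
  by case: rA => -[H _]; exact: (H x s sr sA).
have /choice [c cP] x : exists s, X x -> extends s r /\ forces extends s (Defs.Mem x A).
  have [[s sr sA]|nX] := pselect (X x); first by exists s.
  by exists p => /nX.
have both x y : X x -> X y -> compatible extends (c x) (c y) -> exists s,
    [/\ extends s r, forces extends s (Defs.Mem x A) & forces extends s (Defs.Mem y A)].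
  move=> /cP [cr cA] /cP [_ cA'] [s [sx sy]]; exists s; split.
  - exact: (leP_trans extends_poset sx).
  - exact: (forces_mono extends_poset sx).
  - exact: (forces_mono extends_poset sy).
have srefl s : extends s s by apply: (leP_refl extends_poset).
case: rA => -[_ rA].
  have [//|x [y [Xx Xy nxy cc /= xy]]] := @compatible_amalgam _ m c id false a X bX.
  have [s [sr sx sy]] := both x y Xx Xy cc.
  have [t [ts]] := rA x y s sr sx s (srefl s) sy s (srefl s).
  have eqxy : (forall j, leS (tnth x j) (tnth y j) \/ leS (tnth y j) (tnth x j)) -> False.
    by move=> h; apply: nxy; apply: eq_from_tnth => j; apply: xy.
  by case=> [/absL h|/absL h]; apply: eqxy => j; [left|right]; apply: h.
have [|x [y [Xx Xy nxy cc /= xy]]] := @compatible_amalgam _ m c id true a X bX.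
  split=> // x j /domX /(derived_dom hsuslin) [xa _]; exact: xa.
have [s [sr sx sy]] := both x y Xx Xy cc.
apply: nxy; apply: (rA x y s sr sx s (srefl s) sy s (srefl s)).
exact/absL.
Qed.

(** Above [a] the first [n.+1] entries of a tuple are distinct, so the generic function labels them.
    Comparable tuples with one label share these entries and are therefore equal. *)
Lemma forces_derived_special p : n < m -> forces extends p (special (derived Tn a)).
Proof.
move=> nm; split; first exact: forces_derived_tree.
split; first exact: forces_derived_height.
have [absD absL] := absolute_derived a.
have [ainj ah] := proj1 (distinct_level hsuslin a) da.
pose i0 : 'I_m := Ordinal m0.
pose tr (x : m.-tuple S) : n.+1.-tuple S := [tuple tnth x (widen_ord nm i) | i < n.+1].
have trE x i : tnth (tr x) i = tnth x (widen_ord nm i) by rewrite tnth_mktuple.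
pose up (x : m.-tuple S) := forall i, leS (tnth a i) (tnth x i).
have up_node x : holds (dom (derived T a) x) -> up x -> node (tr x).
  move=> /(derived_dom hsuslin) [_ xx] ux; split=> [i j|i j]; rewrite !trE //.
  move=> xij; suff /(congr1 val) /= /val_inj : widen_ord nm i = widen_ord nm j by [].
  apply: ainj; apply: (eq_height hsuslin (ux _)); last exact: ah.
  by rewrite xij; apply: ux.
(* A tuple not above [a] has an entry below that of [a], so its height is bounded by the level of
   [a]. *)
have [e eP] : ctb (fun x => holds (dom (derived T a) x) /\ ~ up x).
  apply: (@ctb_preim _ _ (@tnth m S) _ (fun f => forall i, hle T T (f i) (tnth a i0))).
  - move=> x [/(derived_dom hsuslin) [xa xx] /existsNP [i nxi]] j.
    have xi : leS (tnth x i) (tnth a i) by case: (xa i).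
    apply: (height_trans hsuslin (proj1 (xx j i))).
    exact: (height_trans hsuslin (height_mono hsuslin xi) (proj1 (ah i i0))).
  - by move=> x y _ _ xy; apply: eq_from_tnth => i; rewrite xy.
  - by apply: (@ctb_fun _ _ (fun s => hle T T s _)); apply: (ctb_hle hsuslin).
(* The generic function is only defined on injective tuples; the countably many
   tuples of the derived tree that are not above [a] get the even values. *)
pose F : name cond (m.-tuple S * nat) := fun xk q =>
  holds (dom (derived T a) xk.1) /\
  ((up xk.1 /\ exists2 k, xk.2 = k.*2.+1 & sval q (tr xk.1, k)) \/
   (~ up xk.1 /\ xk.2 = (e xk.1).*2)).
have srefl s : extends s s by apply: (leP_refl extends_poset).
have Fmono x q q' : extends q' q -> F x q -> F x q'.
  move=> q'q [Dx [[ux [k xk qk]]|ux]]; split=> //; last by right.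
  by left; split=> //; exists k => //; apply: q'q.
have Fext q x : forces extends q (Defs.Mem x F) -> exists2 r, extends r q & F x r.
  move=> /(_ q (srefl q)) [r [s [rq Fs rs]]]; exists r => //.
  exact: Fmono rs Fs.
have Fmem q x : F x q -> forces extends q (Defs.Mem x F).
  by move=> Fq q' q'q; exists q', q.
have Fext2 q x y : forces extends q (Defs.Mem x F) ->
    forces extends q (Defs.Mem y F) -> exists r, [/\ extends r q, F x r & F y r].
  move=> /Fext [r rq Fx] qy.
  have [s sr Fy] := Fext r y (forces_mono extends_poset rq qy).
  exists s; split=> //; first exact: (leP_trans extends_poset sr).
  exact: Fmono sr Fx.
move=> p1 _; exists p1; split; first exact: srefl.
exists F; split; [split|].
- move=> x k q _ /Fext [r _ [Dx _]]; split=> //.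
  exact/absD.
- move=> x q _ /absD Dx q' q'q.
  have [k [r rq' Fr]] : exists k, exists2 r, extends r q' & F (x, k) r.
    have [ux|nux] := pselect (up x).
      have [r rq' [k rk]] := extends_dense q' (up_node x Dx ux).
      by exists k.*2.+1, r => //; split=> //; left; split=> //; exists k.
    by exists (e x).*2, q' => //; split=> //; right.
  exists r; split=> //; exists k; split; first exact: Fmem.
  move=> k' s sr Fk'.
  have [t ts Ft'] := Fext _ _ Fk'.
  have Ft := Fmono _ _ _ (leP_trans extends_poset ts sr) Fr.
  case: Ft' Ft => _ /= [[ux [z' -> tz']]|[nux ->]] [_ /= [[ux' [z -> tz]]|[nux' ->]]] //.
  have [_ _ H _] := proj2_sig t.
  by rewrite (H _ _ _ tz tz').
- move=> x y k q _ Fx q' q'q Fy q2 q2q' /(absolute_tlt extends_poset (absolute_derived a)).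
  move=> [xy nxy].
  have Fx' := @forces_mono _ _ extends_poset (Defs.Mem (x, k) F) q q' q'q Fx.
  have [t [_ [Dx Ftx] [Dy Fty]]] := Fext2 _ _ _ Fx' Fy.
  (* Parity separates the two kinds of labels; within a kind, the condition [t] or the injectivity
     of [e] decides. *)
  apply: nxy; case: Ftx Fty => /= [[ux [z -> tz]]|[nux ->]] [[uy [z' zz' tz']]|[nuy ek]].
  + have zz : z = z' by move: zz' => [] /double_inj.
    have [_ _ _ H] := proj2_sig t.
    have trxy : tr x = tr y.
      apply: (H _ _ z); [exact: tz|by rewrite zz|].
      by move=> i; rewrite !trE; apply: xy.
    apply: (@derived_eq x y (widen_ord nm ord0)) => //.
    by rewrite -!trE trxy.
  + by move: ek => /(congr1 odd); rewrite /= !odd_double.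
  + by move: zz' => /(congr1 odd); rewrite /= !odd_double.
  + by apply: eP => //; apply: double_inj.
Qed.

End Derived.

End Poset.

Theorem theorem4p3 (S : Type) (leS : S -> S -> Prop)
    (hsuslin : holds (suslin (ground leS)))
    (hnormal : holds (normal (ground leS)))
    (hfree : holds (free (ground leS)))
    (n : nat) (hn : 0 < n) :
  exists (P : Type) (leP : P -> P -> Prop),
    forcing_poset leP /\ ccc leP /\
    forall p : P,
      forces leP p (And (n_free n (ground leS))
                        (derived_special_above n (ground leS))).
Proof.
exists (cond leS n), (@extends S leS n).
split; first exact: extends_poset.
split; first exact: extends_ccc.
move=> p; split=> [a q _ /(absolute_distinct hsuslin) da|m q _ nm a r _
    /(absolute_distinct hsuslin) da].
  exact: forces_derived_suslin.
by apply: forces_derived_special => //; apply: leq_trans nm.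
Qed.
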